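(* Let $k\ge1$ be an integer and let $E\in V_k\Lambda^1(\mathfrak N^4)$ be a polynomial 1-form for which all the degrees of freedom $\Sigma^{k,1}(\mathfrak N^4)$ vanish. Then $E\equiv0$.
   Context: The reference tetrahedral prism is $\mathfrak N^4=\mathfrak T^3\times\mathfrak T^1$, where $\mathfrak T^3=\{(x_1,x_2,x_3): -1\le x_i\le1,\ x_1+x_2+x_3\le-1\}$ is a tetrahedron with vertices $(1,-1,-1),(-1,1,-1),(-1,-1,1),(-1,-1,-1)$ and barycentric coordinates $\lambda_1,\dots,\lambda_4$ (in that order), and $\mathfrak T^1=[-1,1]$ (variable $x_4$) with barycentric coordinates $\nu_1,\nu_2$. It has 16 edges, 8 triangular faces (in $x_4=\pm1$), 6 quadrilateral faces (edge of $\mathfrak T^3$ times $\mathfrak T^1$), 2 tetrahedral facets ($x_4=\pm1$) and 4 triangular-prism facets (triangular face of $\mathfrak T^3$ times $\mathfrak T^1$). $P^j(\cdot)$ are polynomials of total degree $\le j$ on the indicated set ($\{0\}$ if $j<0$), $\tilde P^j$ homogeneous of degree exactly $j$ (together with $0$); $A\times B$ of spaces means the span of products; $Q^{a,b}$ on a quadrilateral face is the space of polynomials of degree $\le a$ along the edge of $\mathfrak T^3$ and $\le b$ in $x_4$. $dP^j$ is the same polynomial space as $P^j$ (the notation only indicates that no inter-element continuity is imposed). With $y=(x_1,x_2,x_3)$ let $N^{k-1}(\mathfrak T^3)=(P^{k-1}(\mathfrak T^3))^3\oplus\{p\in(\tilde P^k(\mathfrak T^3))^3:p\cdot y=0\}$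 (first-kind Nédélec space). Then $$V_k\Lambda^1(\mathfrak N^4)=\Big(P^k(\mathfrak T^1)\times\begin{bmatrix}N^{k-1}(\mathfrak T^3)\\0\end{bmatrix}\Big)\oplus\Big([0,0,0,P^{k-1}(\mathfrak T^1)]^T\times P^k(\mathfrak T^3)\Big).$$ For $r=1,2,3$ let $(a,b,c,d)=(1,2,3,4),(2,3,4,1),(3,4,1,2)$ respectively, and $\Phi^{b,r}=\lambda_c\lambda_d$, $N^r=\lambda_a\nabla\lambda_b-\lambda_b\nabla\lambda_a$ (3-vector in $x_1,x_2,x_3$). Put $\vartheta^b(x_1,x_2,x_3)=\lambda_1\lambda_2\lambda_3\lambda_4$ and $\vartheta^b(x_4)=\nu_1\nu_2$. Degrees of freedom $\Sigma^{k,1}(\mathfrak N^4)$ of $E$: - $\int_e(E\cdot\tau)q$, $q\in P^{k-1}(e)$, each edge $e$ with unit tangent $\tau$; - $\int_fE\cdot q$, each triangular face $f$ and each $q$ tangent to $f$ with components in $P^{k-2}(f)$; - for each quadrilateral face $f=e\times\mathfrak T^1$, with $\tau_e$ the unit tangent of $e$ and $e_4$ the $x_4$ unit vector: $\int_f(E\cdot e_4)q$ for $q\in Q^{k-2,k-1}(f)$ and $\int_f(E\cdot\tau_e)q$ for $q\in Q^{k-1,k-2}(f)$; - $\int_{\mathcal F}E\cdot q$, each tetrahedral facet $\mathcal F$ and each $q$ tangent to $\mathcal F$ with components in $P^{k-3}(\mathcal F)$; - for each triangular-prism facet $\mathcal F=T\times\mathfrak T^1$: $\int_{\mathcal F}E\cdot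 q$ for $q$ tangent to $T$ with components in $P^{k-2}(\mathfrak T^1)\times P^{k-2}(T)$, and $\int_{\mathcal F}(E\cdot e_4)q$ for $q\in P^{k-1}(\mathfrak T^1)\times P^{k-3}(T)$; - $\int_{\mathfrak N^4}E\cdot\Big(\sum_{r=1}^3q^r\,\Phi^{b,r}\,\vartheta^b(x_4)\begin{bmatrix}N^r\\0\end{bmatrix}\Big)$, for all $q^1,q^2,q^3\in P^{k-2}(\mathfrak T^1)\times P^{k-3}(\mathfrak T^3)$; - $\int_{\mathfrak N^4}E\cdot[0,0,0,q^4\,\vartheta^b(x_1,x_2,x_3)]^T$, $q^4\in dP^{k-1}(\mathfrak T^1)\times P^{k-4}(\mathfrak T^3)$. *)

(* Defs.v *)
From HB Require Import structures.
From mathcomp Require Import all_boot all_order all_algebra.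
From mathcomp Require Import all_classical all_reals all_analysis.
From mathcomp Require Import lra.
(* The notations of mpoly clash with those of the analysis library. *)
From mathcomp Require mpoly.
Export -(notations) mpoly.

Set Implicit Arguments.
Unset Strict Implicit.
Unset Printing Implicit Defensive.
Import Order.TTheory GRing.Theory Num.Theory.
Local Open Scope classical_set_scope.
Local Open Scope ring_scope.

Section Prism.
Variable R : realType.

(* R^4 = R^3 x R; points are row vectors x = (y, x_4). *)
Definition pt (y : 'rV[R]_3) (t : R) : 'rV[R]_4 := row_mx y t%:M.
Definition ypart (x : 'rV[R]_4) : 'rV[R]_3 := @lsubmx R 1 3 1 x.
Definition x4 (x : 'rV[R]_4) : R := x 0 ord_max.
Definition e4 : 'rV[R]_4 := pt 0 1.

Definition dot n (u v : 'rV[R]_n) : R := (u *m v^T) 0 0.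
Definition enorm n (u : 'rV[R]_n) : R := Num.sqrt (dot u u).

(* Degrees are integers: for j < 0 these spaces are {0}.  Recall that
   [size p] and [msize p] are one more than the (total) degree of p. *)
Definition Ppoly n (j : int) : set ('rV[R]_n -> R) :=
  [set f : 'rV[R]_n -> R | exists p : mpoly n R,
     (p = 0 \/ ((msize p)%:Z <= j + 1)%R) /\
     (forall x, f x = meval (fun i => x 0 i) p)].

Definition P1poly (j : int) : set (R -> R) :=
  [set f | exists p : {poly R},
     (p = 0 \/ ((size p)%:Z <= j + 1)%R) /\ (forall t, f t = p.[t])].

Definition Phomog n (j : nat) : set ('rV[R]_n -> R) :=
  [set f : 'rV[R]_n -> R | exists p : mpoly n R,
     p \is @ishomog1 n R j mdeg /\
     (forall x, f x = meval (fun i => x 0 i) p)].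

(* A x B, i.e. the span of the products a(x_4) b(y).  A and B are always linear
   subspaces here, so that sums of products make up the whole span. *)
Definition tprod (V : lmodType R) (A : set (R -> R)) (B : set ('rV[R]_3 -> V)) :
    set ('rV[R]_4 -> V) :=
  [set f | exists (m : nat) (a : 'I_m -> R -> R) (b : 'I_m -> 'rV[R]_3 -> V),
     (forall i, A (a i) /\ B (b i)) /\
     (forall x, f x = \sum_(i < m) a i (x4 x) *: b i (ypart x))].

Definition tprodS (A : set (R -> R)) (B : set ('rV[R]_3 -> R)) :
    set ('rV[R]_4 -> R) := @tprod R^o A B.

(* First-kind Nedelec space N^j on R^3. *)
Definition nedelec (j : nat) : set ('rV[R]_3 -> 'rV[R]_3) :=
  [set u | exists p h : 'rV[R]_3 -> 'rV[R]_3,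
     [/\ (forall i, Ppoly j%:Z (fun y => p y 0 i)),
         (forall i, Phomog j.+1 (fun y => h y 0 i)),
         (forall y, dot (h y) y = 0) &
         (forall y, u y = p y + h y)]].

Definition VkL1 (k : nat) : set ('rV[R]_4 -> 'rV[R]_4) :=
  [set E | exists (A : 'rV[R]_4 -> 'rV[R]_3) (B : 'rV[R]_4 -> R),
     [/\ tprod (P1poly k%:Z) (nedelec k.-1) A,
         tprodS (P1poly (k%:Z - 1)) (Ppoly k%:Z) B &
         (forall x, E x = pt (A x) 0 + pt 0 (B x))]].

Definition T3 : set 'rV[R]_3 :=
  [set y | (forall i, -1 <= y 0 i <= 1) /\ \sum_i y 0 i <= -1].

Definition N4 : set 'rV[R]_4 := [set x | T3 (ypart x) /\ -1 <= x4 x <= 1].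

Definition vtx (i : 'I_4) : 'rV[R]_3 :=
  \row_(j < 3) (if i == j :> nat then 1 else -1).

(* A flat n-dimensional cell of R^4: the image of [cdom] under
   s |-> corig + s *m cdir; the rows of [cdir] span its tangent space. *)
Record cell (n : nat) := Cell {
  cdom : set 'rV[R]_n;
  corig : 'rV[R]_4;
  cdir : 'M[R]_(n, 4) }.

Definition cmap n (c : cell n) (s : 'rV[R]_n) : 'rV[R]_4 :=
  corig c + s *m cdir c.
Definition cset n (c : cell n) : set 'rV[R]_4 := cmap c @` cdom c.

Definition std_simplex n : set 'rV[R]_n :=
  [set s | (forall i, 0 <= s 0 i) /\ \sum_i s 0 i <= 1].

(* The n-dimensional faces of T^3, each given by the increasing list of the
   indices of its vertices. *)
Definition is_face n (w : 'I_n.+1 -> 'I_4) : Prop :=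
  forall i j : 'I_n.+1, (i < j)%N -> (w i < w j)%N.

Definition fdir n (w : 'I_n.+1 -> 'I_4) : 'M[R]_(n, 4) :=
  \matrix_(i < n) pt (vtx (w (lift ord0 i)) - vtx (w ord0)) 0.

(* F x {t}, for a face F of T^3 *)
Definition hcell n (w : 'I_n.+1 -> 'I_4) (t : R) : cell n :=
  Cell (@std_simplex n) (pt (vtx (w ord0)) t) (fdir w).

(* F x T^1, for a face F of T^3 *)
Definition vcell n (w : 'I_n.+1 -> 'I_4) : cell (n + 1) :=
  Cell [set s : 'rV[R]_(n + 1) |
          std_simplex (lsubmx s) /\ -1 <= rsubmx s 0 0 <= 1]
       (pt (vtx (w ord0)) 0) (col_mx (fdir w) e4).

Local Notation leb := (@lebesgue_measure R).

Definition row1 (s : R) : 'rV[R]_1 := \row_i [:: s]`_i.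
Definition row2 (s : R * R) : 'rV[R]_2 := \row_i [:: s.1; s.2]`_i.
Definition row3 (s : R * R * R) : 'rV[R]_3 :=
  \row_i [:: s.1.1; s.1.2; s.2]`_i.
Definition row4 (s : R * R * R * R) : 'rV[R]_4 :=
  \row_i [:: s.1.1.1; s.1.1.2; s.1.2; s.2]`_i.

(* Surface integrals: Lebesgue integrals over the parameter domain, weighted by
   the Gram determinant factor of the parametrization. *)
Definition gram n (J : 'M[R]_(n, 4)) : R := Num.sqrt (\det (J *m J^T)).

Definition cint1 (c : cell 1) (f : 'rV[R]_4 -> R) : \bar R :=
  (\int[leb]_(s in row1 @^-1` cdom c)
     (f (cmap c (row1 s)) * gram (cdir c))%:E)%E.
Definition cint2 (c : cell 2) (f : 'rV[R]_4 -> R) : \bar R :=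
  (\int[(leb \x leb)%E]_(s in row2 @^-1` cdom c)
     (f (cmap c (row2 s)) * gram (cdir c))%:E)%E.
Definition cint3 (c : cell 3) (f : 'rV[R]_4 -> R) : \bar R :=
  (\int[(leb \x leb \x leb)%E]_(s in row3 @^-1` cdom c)
     (f (cmap c (row3 s)) * gram (cdir c))%:E)%E.
Definition intN4 (f : 'rV[R]_4 -> R) : \bar R :=
  (\int[(leb \x leb \x leb \x leb)%E]_(s in row4 @^-1` N4) (f (row4 s))%:E)%E.

(* lambda_i = (1 + x_i) / 2 for i <= 3, lambda_4 = - (1 + x_1 + x_2 + x_3) / 2 *)
Definition lamp (i : 'I_4) : mpoly 3 R :=
  match unlift ord_max i with
  | Some j => 2^-1 *: (1 + mpolyX R (mnm1 j))
  | None => - (2^-1 *: (1 + \sum_(j < 3) mpolyX R (mnm1 j)))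
  end.

Definition lam (i : 'I_4) (y : 'rV[R]_3) : R := meval (fun j => y 0 j) (lamp i).
Definition grad_lam (i : 'I_4) (y : 'rV[R]_3) : 'rV[R]_3 :=
  \row_j meval (fun l => y 0 l) (mderiv j (lamp i)).

Lemma lam_vtx i j : lam i (vtx j) = (i == j)%:R.
Proof.
have h (x : R) : 2^-1 * (1 + x) = (1 + x) / 2 by rewrite mulrC.
rewrite /lam /lamp; case: unliftP => [l|] ->.
  rewrite mevalZ mevalD meval1 mevalXU mxE h -[RHS]mul1r.
  have -> : (j == l :> nat) = (lift ord_max l == j).
    by rewrite -val_eqE /= /bump leqNgt ltn_ord add0n eq_sym.
  by case: ifP => _; rewrite ?subrr ?mul0r ?mulr0 // mulr1 divff ?pnatr_eq0.
rewrite mevalN mevalZ mevalD meval1 raddf_sum /= !big_ord_recl big_ord0 /=.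
rewrite !mevalXU !mxE /= addr0.
case: j => -[|[|[|[|//]]]] ij; rewrite -val_eqE /=; lra.
Qed.

Definition nu1 (t : R) : R := (1 - t) / 2.
Definition nu2 (t : R) : R := (1 + t) / 2.

Definition bub3 (y : 'rV[R]_3) : R := \prod_(i < 4) lam i y.
Definition bub1 (t : R) : R := nu1 t * nu2 t.

(* For r = 0, 1, 2 the quadruple (a, b, c, d) is (cyc r 0, ..., cyc r 3). *)
Definition cyc (r : 'I_3) (m : nat) : 'I_4 := inord ((r + m) %% 4).

Definition Phib (r : 'I_3) (y : 'rV[R]_3) : R :=
  lam (cyc r 2) y * lam (cyc r 3) y.
Definition Nwhit (r : 'I_3) (y : 'rV[R]_3) : 'rV[R]_3 :=
  lam (cyc r 0) y *: grad_lam (cyc r 1) y -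
  lam (cyc r 1) y *: grad_lam (cyc r 0) y.

(* Test fields on c that are tangent to the row space of J and whose components
   lie in S.  A function space on a cell consists of the restrictions to the
   cell of the functions of the given space on R^4. *)
Definition tangent_field n m (J : 'M[R]_(m, 4)) (c : cell n)
    (S : set ('rV[R]_4 -> R)) : set ('rV[R]_4 -> 'rV[R]_4) :=
  [set q : 'rV[R]_4 -> 'rV[R]_4 | (forall i, S (fun x => q x 0 i)) /\
           (forall x, cset c x -> (q x <= J)%MS)].

Definition utan (u : 'rV[R]_4) : 'rV[R]_4 := (enorm u)^-1 *: u.

Section Dofs.
Variables (k : nat) (E : 'rV[R]_4 -> 'rV[R]_4).

Local Notation K := (k%:Z).

Definition dof_edge_on (e : cell 1) : Prop :=
  forall q, Ppoly (K - 1) q ->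
    cint1 e (fun x => dot (E x) (utan (row 0 (cdir e))) * q x) = 0%E.

Definition dof_edges : Prop :=
  (forall (w : 'I_2 -> 'I_4) t, is_face w -> t = -1 \/ t = 1 ->
     dof_edge_on (hcell w t)) /\
  (forall w : 'I_1 -> 'I_4, is_face w -> dof_edge_on (vcell w)).

Definition dof_triangles : Prop :=
  forall (w : 'I_3 -> 'I_4) t, is_face w -> t = -1 \/ t = 1 ->
  forall q, tangent_field (fdir w) (hcell w t) (Ppoly (K - 2)) q ->
    cint2 (hcell w t) (fun x => dot (E x) (q x)) = 0%E.

(* Q^{a,b}(e x T^1) is the restriction of P^b(T^1) x P^a(T^3). *)
Definition dof_quads : Prop :=
  forall w : 'I_2 -> 'I_4, is_face w ->
  (forall q, tprodS (P1poly (K - 1)) (Ppoly (K - 2)) q ->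
     cint2 (vcell w) (fun x => dot (E x) e4 * q x) = 0%E) /\
  (forall q, tprodS (P1poly (K - 2)) (Ppoly (K - 1)) q ->
     cint2 (vcell w) (fun x => dot (E x) (utan (row 0 (fdir w))) * q x) = 0%E).

Definition dof_tets : Prop :=
  forall (w : 'I_4 -> 'I_4) t, is_face w -> t = -1 \/ t = 1 ->
  forall q, tangent_field (fdir w) (hcell w t) (Ppoly (K - 3)) q ->
    cint3 (hcell w t) (fun x => dot (E x) (q x)) = 0%E.

Definition dof_prisms : Prop :=
  forall w : 'I_3 -> 'I_4, is_face w ->
  (forall q, tangent_field (fdir w) (vcell w)
               (tprodS (P1poly (K - 2)) (Ppoly (K - 2))) q ->
     cint3 (vcell w) (fun x => dot (E x) (q x)) = 0%E) /\
  (forall q, tprodS (P1poly (K - 1)) (Ppoly (K - 3)) q ->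
     cint3 (vcell w) (fun x => dot (E x) e4 * q x) = 0%E).

Definition dof_int_y : Prop :=
  forall q : 'I_3 -> 'rV[R]_4 -> R,
  (forall r, tprodS (P1poly (K - 2)) (Ppoly (K - 3)) (q r)) ->
  intN4 (fun x => dot (E x)
    (\sum_r (q r x * Phib r (ypart x) * bub1 (x4 x)) *:
            pt (Nwhit r (ypart x)) 0)) = 0%E.

Definition dof_int_4 : Prop :=
  forall q, tprodS (P1poly (K - 1)) (Ppoly (K - 4)) q ->
  intN4 (fun x => dot (E x) (pt 0 (q x * bub3 (ypart x)))) = 0%E.

Definition dofs_vanish : Prop :=
  [/\ dof_edges, dof_triangles & dof_quads] /\
  [/\ dof_tets, dof_prisms, dof_int_y & dof_int_4].

End Dofs.

End Prism.

(* Main.v *)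
Require Import Defs.
From mathcomp Require Import all_boot all_order all_algebra.
From mathcomp Require Import all_classical all_reals all_analysis.
From mathcomp Require Import ring lra zify.

(** Write points of the prism as (y, t).  A field of the space has a tangential
    part A, a polynomial in t with coefficients in the first-kind Nedelec space,
    and a vertical part B, a polynomial in t with polynomial coefficients in y.
    The plan is the usual one: show that the traces vanish on cells of
    increasing dimension, write what remains as bubbles times polynomials, and
    use these polynomials as test functions, which makes the remaining moment
    the integral of a weighted sum of squares.

    Two observations keep this elementary.  First, for a Nedelec field u and a
    vertex v_l of the tetrahedron, the function U_l(y) = u(y).(v_l - y) (vdot)
    has degree at most k, although u(y).y alone looks like degree k + 1: the
    homogeneous part of u is orthogonal to y.  On a face with barycentric
    coordinates b_l one has sum b_l U_l = 0, and the tangential trace of u on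
    the face vanishes exactly when all its U_l do.  If the trace vanishes on the
    facets b_i = 0 of an n-dimensional face, then U_l is divisible by the
    product of the b_i with i <> l, so U_l = (prod_(i <> l) b_i) V_l with V_l of
    degree at most k - n, and sum b_l U_l = 0 becomes sum V_l = 0 (ned_bubble).
    Therefore q = sum V_l v_l is a tangent test field of the admissible degree,
    and u.q = sum V_l U_l = sum (prod_(i <> l) b_i) V_l^2 is nonnegative; its
    integral vanishes only if every V_l is zero (tvanish_step).  Induction over
    edges, triangles and the tetrahedron gives A = 0 at t = -1 and t = 1.

    Second, A is then (1 - t)(1 + t)/4 times a polynomial in t with Nedelec
    coefficients (bub1_division), and the same argument, applied to all these
    coefficients at once with the weight (1 - t)(1 + t)/4, handles the
    quadrilaterals and the triangular prisms (tvanish_time_step).  In the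
    interior, sum V_l = 0 lets one write the remaining bubble in the basis of
    differences of neighbouring vertices, which turns it into a combination of
    the fields Phi^r N^r of the interior moments (whitney_expansion); so A is
    itself an admissible test field, and the integral of |A|^2 is zero.  The
    vertical part is simpler: its coefficients are divided by the product of all
    the barycentric coordinates of each face in turn (scalar_time_step).

    On the analytic side one needs only that an integral over a set containing a
    ball detects nonnegative continuous functions (definite), that polynomials
    vanishing on a ball vanish (polyfun_ball_eq0), and that the Gram factors of
    the parametrizations are positive (gram_gt0). *)

Set Implicit Arguments.
Unset Strict Implicit.
Unset Printing Implicit Defensive.
Import Order.TTheory GRing.Theory Num.Theory.
Import numFieldNormedType.Exports HBNNSimple.
Local Open Scope classical_set_scope.
Local Open Scope ring_scope.

(** * Polynomial functions of bounded degree *)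

Lemma continuous_big_sum (R : realType) (T : topologicalType) (I : Type)
    (r : seq I) (P : pred I) (F : I -> T -> R) :
  (forall i, continuous (F i)) ->
  continuous (fun x => \sum_(i <- r | P i) F i x).
Proof.
move=> Fc; elim: r => [|i r IH].
  rewrite (_ : (fun _ => _) = fun=> 0); first exact: cst_continuous.
  by apply/funext => x; rewrite big_nil.
rewrite (_ : (fun _ => _) = fun x =>
    (if P i then F i x else 0) + \sum_(i <- r | P i) F i x).
  move=> x; apply: continuousD; last exact: IH.
  by case: (P i); [exact: Fc|exact: cst_continuous].
by apply/funext => x; rewrite big_cons; case: (P i) => //; rewrite add0r.
Qed.

Section PolynomialFunctions.
Variables (R : realType) (n : nat).
Implicit Types (f g : 'rV[R]_n -> R) (m : nat).

(** Polynomial functions of total degree less than m, in Horner form.  Counting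
    from m = 0, where only the zero function remains, matches the convention
    that spaces of negative degree are zero, and makes every closure property an
    induction on m. *)
Fixpoint polyfun m f : Prop :=
  if m is m'.+1 then
    exists (c : R) (g : 'I_n -> 'rV[R]_n -> R),
      (forall i, polyfun m' (g i)) /\
      (forall s, f s = c + \sum_i s 0 i * g i s)
  else forall s, f s = 0.

Lemma polyfun_ext m f g : (forall s, f s = g s) -> polyfun m f -> polyfun m g.
Proof.
case: m => [|m] fg /=; first by move=> f0 s; rewrite -fg.
by move=> [c [h [hP fE]]]; exists c, h; split=> // s; rewrite -fg.
Qed.

Lemma polyfun0 m : polyfun m (fun=> 0).
Proof.
elim: m => [//|m IH] /=; exists 0, (fun _ _ => 0); split=> // s.
by rewrite add0r big1 // => i _; rewrite mulr0.
Qed.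

Lemma polyfun_cst m c : polyfun m.+1 (fun=> c).
Proof.
exists c, (fun _ _ => 0); split=> [i|s]; first exact: polyfun0.
by rewrite big1 ?addr0 // => i _; rewrite mulr0.
Qed.

Lemma polyfunD m f g : polyfun m f -> polyfun m g ->
  polyfun m (fun s => f s + g s).
Proof.
elim: m f g => [|m IH] f g /=; first by move=> f0 g0 s; rewrite f0 g0 addr0.
move=> [c [p [pP fE]]] [d [q [qP gE]]].
exists (c + d), (fun i s => p i s + q i s); split=> [i|s]; first exact: IH.
under eq_bigr do rewrite mulrDr.
by rewrite fE gE big_split /= addrACA.
Qed.

Lemma polyfunZ m a f : polyfun m f -> polyfun m (fun s => a * f s).
Proof.
elim: m f => [|m IH] f /=; first by move=> f0 s; rewrite f0 mulr0.
move=> [c [p [pP fE]]]; exists (a * c), (fun i s => a * p i s).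
split=> [i|s]; first exact: IH.
by rewrite fE mulrDr mulr_sumr; congr (_ + _); apply: eq_bigr => i _; ring.
Qed.

Lemma polyfunB m f g : polyfun m f -> polyfun m g ->
  polyfun m (fun s => f s - g s).
Proof.
move=> fP gP; apply: (@polyfun_ext _ (fun s => f s + -1 * g s)) => [s|].
  by rewrite mulN1r.
by apply: polyfunD => //; apply: polyfunZ.
Qed.

Lemma polyfun_sum m (I : Type) (r : seq I) (P : pred I)
    (F : I -> 'rV[R]_n -> R) :
  (forall i, P i -> polyfun m (F i)) ->
  polyfun m (fun s => \sum_(i <- r | P i) F i s).
Proof.
move=> FP; elim: r => [|i r IH].
  apply: polyfun_ext (polyfun0 m) => s; by rewrite big_nil.
case Pi: (P i).
  apply: (@polyfun_ext _ (fun s => F i s + \sum_(j <- r | P j) F j s)).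
    by move=> s; rewrite big_cons Pi.
  exact: polyfunD (FP _ Pi) IH.
by apply: polyfun_ext IH => s; rewrite big_cons Pi.
Qed.

Lemma polyfunS m f : polyfun m f -> polyfun m.+1 f.
Proof.
elim: m f => [|m IH] f.
  by move=> f0; apply: polyfun_ext (polyfun0 _) => s; rewrite f0.
move=> [c [g [gP fE]]]; exists c, g; split; last exact: fE.
by move=> i; exact: IH (gP i).
Qed.

Lemma polyfun_leq m1 m2 f : (m1 <= m2)%N -> polyfun m1 f -> polyfun m2 f.
Proof.
move=> le12 fP; rewrite -(subnK le12).
by elim: (m2 - m1)%N => [|d IH]; rewrite ?add0n // addSn; apply: polyfunS.
Qed.

Lemma polyfunMX m i f : polyfun m f -> polyfun m.+1 (fun s => s 0 i * f s).
Proof.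
move=> fP; exists 0, (fun j s => if j == i then f s else 0); split=> [j|s].
  by case: (j == i); [exact: fP|exact: polyfun0].
rewrite add0r (bigD1 i) //= eqxx big1 ?addr0 // => j /negbTE ->.
by rewrite mulr0.
Qed.

Lemma polyfunM_aff m f g : polyfun 2 g -> polyfun m f ->
  polyfun m.+1 (fun s => g s * f s).
Proof.
case=> c [h [hP gE]] fP.
have {hP} hP i : exists d, forall s, h i s = d.
  by case: (hP i) => d [e [e0 hE]]; exists d => s;
    rewrite hE big1 ?addr0 // => j _; rewrite e0 mulr0.
apply: (@polyfun_ext _ (fun s => c * f s + \sum_i h i 0 * (s 0 i * f s))).
  move=> s; rewrite gE mulrDl mulr_suml; congr (_ + _).
  apply: eq_bigr => i _; have [d dE] := hP i; rewrite !dE; ring.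
apply: polyfunD; first exact/polyfunS/polyfunZ.
by apply: polyfun_sum => i _; apply/polyfunZ/polyfunMX.
Qed.

Lemma polyfun_coord i : polyfun 2 (fun s => s 0 i).
Proof.
apply: polyfun_ext (polyfunMX i (polyfun_cst 0 1)) => s; by rewrite mulr1.
Qed.

Lemma polyfun_continuous m f : polyfun m f -> continuous f.
Proof.
elim: m f => [|m IH] f /=.
  by move=> f0; rewrite (_ : f = fun=> 0); [exact: cst_continuous|apply/funext].
move=> [c [g [gP fE]]].
rewrite (_ : f = (fun s => c + \sum_i s 0 i * g i s)); last exact/funext.
move=> s; apply: continuousD; first exact: cst_continuous.
apply: continuous_big_sum => i x; apply: continuousM; last exact: IH.
exact: coord_continuous.
Qed.

Lemma polyfun_line m f a b : polyfun m f ->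
  exists p : {poly R}, forall t, f (a + t *: b) = p.[t].
Proof.
elim: m f => [|m IH] f /=; first by move=> f0; exists 0 => t; rewrite f0 horner0.
move=> [c [g [gP fE]]].
have /choice[p pE] : forall i, exists p : {poly R},
    forall t, g i (a + t *: b) = p.[t] by move=> i; apply: IH.
exists (c%:P + \sum_i ((a 0 i)%:P + (b 0 i) *: 'X) * p i) => t.
rewrite fE hornerD hornerC horner_sum; congr (_ + _).
apply: eq_bigr => i _; rewrite pE hornerM hornerD hornerC hornerZ hornerX !mxE.
by rewrite [t * _]mulrC.
Qed.

End PolynomialFunctions.

Lemma polyfun_comp (R : realType) n1 n2 m (f : 'rV[R]_n2 -> R)
    (phi : 'rV[R]_n1 -> 'rV[R]_n2) :
  (forall i, polyfun 2 (fun s => phi s 0 i)) -> polyfun m f ->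
  polyfun m (fun s => f (phi s)).
Proof.
move=> phiP; elim: m f => [|m IH] f /=; first by move=> f0 s; rewrite f0.
move=> [c [g [gP fE]]].
apply: (@polyfun_ext _ _ m.+1 (fun s : 'rV_n1 =>
    c + \sum_i phi s 0 i * g i (phi s))); first by move=> s; rewrite fE.
apply: polyfunD; first exact: polyfun_cst.
apply: polyfun_sum => i _; apply: polyfunM_aff; [exact: phiP|exact: IH].
Qed.

(** A nonzero polynomial has finitely many roots, so it cannot vanish at all the
    points e / (i + 2). *)
Lemma horner_eq0_near0 (R : realType) (p : {poly R}) e : 0 < e ->
  (forall t, `|t| < e -> p.[t] = 0) -> p = 0.
Proof.
move=> e0 p0; have [//|pn0] := eqVneq p 0.
suff : (size p < size p)%N by rewrite ltnn.
pose s := [seq e / (i.+2%:R) | i <- iota 0 (size p)].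
have := @max_poly_roots _ p s pn0; rewrite size_map size_iota; apply.
  apply/allP => x /mapP[i _ ->]; apply/eqP/p0.
  rewrite gtr0_norm ?divr_gt0 // ltr_pdivrMr // ltr_pMr // ltr1n //.
rewrite map_inj_uniq ?iota_uniq // => i j.
move=> /(mulfI (lt0r_neq0 e0)) /invr_inj /eqP; rewrite eqr_nat.
by move=> /eqP[].
Qed.

(** Restricted to the line through the centre and any given point, the function
    is a polynomial in one variable that vanishes near the origin. *)
Lemma polyfun_ball_eq0 (R : realType) n m (f : 'rV[R]_n -> R) c r :
  polyfun m f -> 0 < r -> (forall s, ball c r s -> f s = 0) ->
  forall s, f s = 0.
Proof.
move=> fP r0 f0 s; have [p pE] := polyfun_line c (s - c) fP.
pose N := 1 + \sum_i `|(s - c) 0 i|.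
have N0 : 0 < N by rewrite ltr_wpDr ?ltr01 ?sumr_ge0.
have p0 : p = 0.
  apply: (@horner_eq0_near0 _ _ (r / N)); first by rewrite divr_gt0.
  move=> t tr; rewrite -pE; apply: f0; split => // i j.
  rewrite ord1 /ball /= !mxE opprD addrA subrr add0r normrN normrM.
  rewrite -[X in _ < X](divfK (lt0r_neq0 N0)).
  apply: le_lt_trans (_ : `|t| * N < _); last by rewrite ltr_pM2r.
  apply: ler_wpM2l => //; rewrite /N (bigD1 j) //= addrCA !mxE lerDl.
  by rewrite addr_ge0 ?sumr_ge0.
by have := pE 1; rewrite scale1r addrC subrK p0 horner0.
Qed.

(** On a line both functions are polynomials in one variable, and these have no
    zero divisors. *)
Lemma polyfun_cancel (R : realType) n m1 m2 (f g : 'rV[R]_n -> R) a b :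
  polyfun m1 f -> polyfun m2 g -> f a != 0 ->
  (forall t, f (a + t *: b) * g (a + t *: b) = 0) ->
  forall t, g (a + t *: b) = 0.
Proof.
move=> /(polyfun_line a b)[p pE] /(polyfun_line a b)[q qE] fa fg t.
have p0 : p != 0.
  by apply: contraNneq fa => p0; have := pE 0; rewrite scale0r addr0 p0 horner0 => ->.
suff /eqP : p * q = 0 by rewrite mulf_eq0 (negbTE p0) qE => /eqP ->; rewrite horner0.
apply: (@horner_eq0_near0 _ _ 1) => // u _.
by rewrite hornerM -pE -qE.
Qed.

(** Division with remainder along a direction: the remainder is f composed with
    s |-> s - l(s) v, which is the projection onto the hyperplane l = 0 when l
    grows at unit rate along v.  The remainder then depends only on the values
    of f on that hyperplane, so the division is exact if f vanishes there. *)
Lemma polyfun_div_proj (R : realType) n m (f l : 'rV[R]_n -> R) v :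
  polyfun 2 l -> polyfun m f ->
  exists2 g, polyfun m.-1 g & forall s, f s = f (s - l s *: v) + l s * g s.
Proof.
move=> lP.
have comp p h : polyfun p h -> polyfun p (fun s => h (s - l s *: v)).
  apply: polyfun_comp => i.
  apply: (@polyfun_ext _ _ _ (fun s => s 0 i - v 0 i * l s)) => [s|].
    by rewrite !mxE mulrC.
  by apply: polyfunB; [exact: polyfun_coord|exact: polyfunZ].
elim: m f => [|m IH] f fP.
  by exists (fun=> 0) => // s; rewrite !fP mulr0 addr0.
have /= [c [h [hP fE]]] := fP.
have /choice[g gE] : forall i, exists g, polyfun m.-1 g /\
    forall s, h i s = h i (s - l s *: v) + l s * g s.
  by move=> i; have [g ? ?] := IH _ (hP i); exists g.
case: m IH hP gE fP fE => [|m] IH hP gE fP fE.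
  exists (fun=> 0) => // s; rewrite !fE mulr0 addr0.
  by rewrite !big1 // => i _; rewrite hP mulr0.
exists (fun s : 'rV_n => \sum_i (s 0 i * g i s + v 0 i * h i (s - l s *: v))).
  apply: polyfun_sum => i _; apply: polyfunD; last exact/polyfunZ/comp/hP.
  by have [gP _] := gE i; apply: polyfunMX.
move=> s; rewrite !fE -addrA mulr_sumr -big_split /=; congr (_ + _).
apply: eq_bigr => i _; rewrite !mxE [in LHS](gE i).2; ring.
Qed.

(** * Integrals that detect nonnegative continuous functions *)

(** The simple function e * 1_B lies below the integrand, and the integral of a
    nonnegative function is the supremum over the simple functions below it. *)
Lemma integral_gt0_lower (d : measure_display) (T : measurableType d)
    (R : realType) (mu : {measure set T -> \bar R}) (D B : set T) (f : T -> R)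
    (e : R) :
  measurable B -> (0 < mu B)%E -> B `<=` D -> 0 < e ->
  (forall x, D x -> 0 <= f x) -> (forall x, B x -> e <= f x) ->
  (0 < \int[mu]_(x in D) (f x)%:E)%E.
Proof.
move=> mB muB BD e0 f0 fe; rewrite ge0_integralE; last first.
  by move=> x /f0; rewrite lee_fin.
pose h := scale_nnsfun (indic_nnsfun R mB) (ltW e0).
apply: (@lt_le_trans _ _ (sintegral mu h)).
  rewrite /h /= sintegralrM sintegral_indic.
  by rewrite mule_gt0 // lte_fin.
apply: ereal_sup_ubound; exists h => //= x; rewrite patchE /=
  measurable_realfun.mindicE.
case: ifPn => [|]; case: (boolP (x \in B)) => //=;
  rewrite ?inE ?notin_setE ?mulr1 ?mulr0 //.
- by move=> Bx _; rewrite lee_fin fe.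
- by move=> _ Dx; rewrite lee_fin f0.
- by move=> /BD.
Qed.

Section DefiniteIntegrals.
Variable R : realType.

(** The property of an integral on which unisolvence rests: a nonnegative
    continuous function with zero integral vanishes on every ball inside the
    domain. *)
Definition definite n (I : set 'rV[R]_n -> ('rV[R]_n -> R) -> \bar R) :=
  forall D (f : 'rV[R]_n -> R) c r, 0 < r -> ball c r `<=` D -> continuous f ->
    (forall s, D s -> 0 <= f s) -> I D f = 0%E ->
    forall s, ball c r s -> f s = 0.

(** At a point where f is positive, f exceeds half its value on a small ball,
    and this ball has positive measure. *)
Lemma definite_integral (d : measure_display) (T : measurableType d)
    (mu : {measure set T -> \bar R}) n (row : T -> 'rV[R]_n) :
  (forall c r, 0 < r -> measurable (row @^-1` ball c r) /\
                        (0 < mu (row @^-1` ball c r))%E) ->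
  definite (fun D f => \int[mu]_(s in row @^-1` D) (f (row s))%:E)%E.
Proof.
move=> mball D f c r r0 cD fc f0 If0 s cs; apply/eqP/negPn/negP => fs0.
have fs : 0 < f s by rewrite lt_def fs0 f0 //; exact: cD.
have nD : nbhs s (ball c r).
  by apply: open_nbhs_nbhs; split => //; exact: ball_open.
have nf : nbhs s (f @^-1` [set y | f s / 2 < y]).
  apply: fc; apply: open_nbhs_nbhs; split; first exact: open_gt.
  by rewrite /= ltr_pdivrMr // ltr_pMr // ltr1n.
have [e /= e0 eP] := (nbhs_ballP _ _).1 (filterI nD nf).
have [mB muB] := mball s e e0.
have := @integral_gt0_lower _ _ _ mu (row @^-1` D) _ (fun x => f (row x))
  (f s / 2) mB muB.
rewrite If0 ltxx => F; suff : false by []; apply: F.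
- by move=> x /eP[/cD].
- by rewrite divr_gt0.
- by move=> x; apply: f0.
- by move=> x /eP[_] /ltW.
Qed.

Local Notation leb := (@lebesgue_measure R).

Definition int1 (D : set 'rV[R]_1) f : \bar R :=
  (\int[leb]_(s in @Defs.row1 R @^-1` D) (f (Defs.row1 s))%:E)%E.
Definition int2 (D : set 'rV[R]_2) f : \bar R :=
  (\int[(leb \x leb)%E]_(s in @Defs.row2 R @^-1` D) (f (Defs.row2 s))%:E)%E.
Definition int3 (D : set 'rV[R]_3) f : \bar R :=
  (\int[(leb \x leb \x leb)%E]_(s in @Defs.row3 R @^-1` D) (f (Defs.row3 s))%:E)%E.
Definition int4 (D : set 'rV[R]_4) f : \bar R :=
  (\int[(leb \x leb \x leb \x leb)%E]_(s in @Defs.row4 R @^-1` D)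
     (f (Defs.row4 s))%:E)%E.

Lemma ball_row n (c : 'rV[R]_n) (r : R) s :
  0 < r -> ball c r s <-> forall i, ball (c 0 i) r (s 0 i).
Proof.
by move=> r0; split=> [[_ h] i|h]; [exact: h|split=> // i j; rewrite ord1].
Qed.

Lemma lebesgue_ball_gt0 (x r : R) : 0 < r ->
  measurable (ball x r : set (measurableTypeR R)) /\ (0 < leb (ball x r))%E.
Proof.
move=> r0; split; first by rewrite ball_itv; exact: measurable_itv.
by rewrite lebesgue_measure_ball ?ltW // lte_fin mulrn_wgt0.
Qed.

Lemma product_measure_gt0 (d1 d2 : measure_display) (T1 : measurableType d1)
    (T2 : measurableType d2) (m1 : {measure set T1 -> \bar R})
    (m2 : {sigma_finite_measure set T2 -> \bar R}) A B :
  measurable A /\ (0 < m1 A)%E -> measurable B /\ (0 < m2 B)%E ->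
  measurable (A `*` B) /\ (0 < (m1 \x m2) (A `*` B))%E.
Proof.
move=> [mA m1A] [mB m2B]; split; first exact: measurableX.
by rewrite product_measure1E // mule_gt0.
Qed.

Lemma definite_int1 : definite int1.
Proof.
apply: (@definite_integral _ _ leb) => c r r0.
rewrite (_ : _ @^-1` _ = ball (c 0 0) r); first exact: lebesgue_ball_gt0.
apply/seteqP; split => s.
  by move=> /(ball_row _ _ r0)/(_ 0); rewrite mxE.
by move=> cs; apply/(ball_row _ _ r0) => i; rewrite ord1 mxE.
Qed.

Lemma definite_int2 : definite int2.
Proof.
apply: (@definite_integral _ _ (leb \x leb)%E) => c r r0.
rewrite (_ : _ @^-1` _ = ball (c 0 0) r `*` ball (c 0 1) r).
  by apply: product_measure_gt0; exact: lebesgue_ball_gt0.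
apply/seteqP; split => [[s1 s2]|[s1 s2] [cs1 cs2]].
  by move=> /(ball_row _ _ r0) h; split => /=; [have := h 0|have := h 1];
    rewrite mxE.
apply/(ball_row _ _ r0) => i; rewrite mxE.
case: i => [[|[|//]] /= i2].
  by rewrite (_ : Ordinal _ = 0) //; exact: val_inj.
by rewrite (_ : Ordinal _ = 1) //; exact: val_inj.
Qed.

Lemma definite_int3 : definite int3.
Proof.
apply: (@definite_integral _ _ (leb \x leb \x leb)%E) => c r r0.
pose o2 : 'I_3 := Ordinal (isT : 2 < 3)%N.
rewrite (_ : _ @^-1` _ = ball (c 0 0) r `*` ball (c 0 1) r `*` ball (c 0 o2) r).
  by do 2?apply: product_measure_gt0; exact: lebesgue_ball_gt0.
apply/seteqP; split => [[[s1 s2] s3]|[[s1 s2] s3] [[cs1 cs2] cs3]].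
  by move=> /(ball_row _ _ r0) h; split => /=;
    [split; [have := h 0|have := h 1]|have := h o2]; rewrite mxE.
apply/(ball_row _ _ r0) => i; rewrite mxE.
case: i => [[|[|[|//]]] /= i2].
- by rewrite (_ : Ordinal _ = 0) //; exact: val_inj.
- by rewrite (_ : Ordinal _ = 1) //; exact: val_inj.
- by rewrite (_ : Ordinal _ = o2) //; exact: val_inj.
Qed.

Lemma definite_int4 : definite int4.
Proof.
apply: (@definite_integral _ _ (leb \x leb \x leb \x leb)%E) => c r r0.
pose o2 : 'I_4 := Ordinal (isT : 2 < 4)%N.
pose o3 : 'I_4 := Ordinal (isT : 3 < 4)%N.
rewrite (_ : _ @^-1` _ = ball (c 0 0) r `*` ball (c 0 1) r `*` ball (c 0 o2) r
    `*` ball (c 0 o3) r).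
  by do 3?apply: product_measure_gt0; exact: lebesgue_ball_gt0.
apply/seteqP; split => [[[[s1 s2] s3] s4]|[[[s1 s2] s3] s4]].
  by move=> /(ball_row _ _ r0) h; split => /=;
    [split; [split; [have := h 0|have := h 1]|have := h o2]|have := h o3];
    rewrite mxE.
move=> [[[cs1 cs2] cs3] cs4].
apply/(ball_row _ _ r0) => i; rewrite mxE.
case: i => [[|[|[|[|//]]]] /= i2].
- by rewrite (_ : Ordinal _ = 0) //; exact: val_inj.
- by rewrite (_ : Ordinal _ = 1) //; exact: val_inj.
- by rewrite (_ : Ordinal _ = o2) //; exact: val_inj.
- by rewrite (_ : Ordinal _ = o3) //; exact: val_inj.
Qed.

End DefiniteIntegrals.

(** * Barycentric coordinates and Gram determinants *)

Section Barycentric.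
Variables (R : realType) (n : nat).
Implicit Types (s : 'rV[R]_n) (i l : 'I_n.+1).

Definition bar s i : R :=
  if unlift ord0 i is Some j then s 0 j else 1 - \sum_j s 0 j.

Lemma bar0 s : bar s ord0 = 1 - \sum_j s 0 j.
Proof. by rewrite /bar unlift_none. Qed.

Lemma bar_lift s j : bar s (lift ord0 j) = s 0 j.
Proof. by rewrite /bar liftK. Qed.

Lemma sum_bar s : \sum_i bar s i = 1.
Proof.
rewrite big_ord_recl bar0 [X in _ + X](eq_bigr (fun j => s 0 j)) ?subrK //.
by move=> j _; rewrite bar_lift.
Qed.

Lemma bar_surj (b : 'I_n.+1 -> R) : \sum_i b i = 1 ->
  exists s, forall i, bar s i = b i.
Proof.
move=> b1; exists (\row_j b (lift ord0 j)) => i.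
case: (unliftP ord0 i) => [j|] ->; first by rewrite bar_lift mxE.
rewrite bar0 -b1 big_ord_recl [X in _ - X](eq_bigr (b \o lift ord0)) ?addrK //.
by move=> j _; rewrite mxE.
Qed.

Lemma bar_affine s s1 s2 (c : R) i :
  bar (s + c *: (s1 - s2)) i = bar s i + c * (bar s1 i - bar s2 i).
Proof.
case: (unliftP ord0 i) => [j|] ->; first by rewrite !bar_lift !mxE.
rewrite !bar0 (eq_bigr (fun j => s 0 j + c * (s1 0 j - s2 0 j))).
  by rewrite big_split /= -mulr_sumr sumrB; ring.
by move=> j _; rewrite !mxE.
Qed.

Lemma polyfun_bar i : polyfun 2 (fun s => bar s i).
Proof.
case: (unliftP ord0 i) => [j|] ->.
  by apply: polyfun_ext (polyfun_coord R j) => s; rewrite bar_lift.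
apply: (@polyfun_ext _ _ _ (fun s => 1 - \sum_j s 0 j)) => [s|].
  by rewrite bar0.
apply: polyfunB; first exact: polyfun_cst.
by apply: polyfun_sum => j _; exact: polyfun_coord.
Qed.

Lemma bar_vertex i : exists s, forall l, bar s l = (l == i)%:R.
Proof.
apply: bar_surj; rewrite (bigD1 i) //= eqxx big1 ?addr0 // => l /negbTE -> //.
Qed.

(** The projection onto the hyperplane of the i-th facet is taken along the
    segment that joins vertex i to another vertex; for this a second vertex has
    to exist. *)
Lemma polyfun_div_bar m (f : 'rV[R]_n -> R) i : (0 < n)%N -> polyfun m f ->
  (forall s, bar s i = 0 -> f s = 0) ->
  exists2 g, polyfun m.-1 g & forall s, f s = bar s i * g s.
Proof.
move=> n0 fP f0.
have [l li] : exists l, l != i.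
  case: (unliftP ord0 i) => [j|] ->; first by exists ord0; rewrite eq_sym lift_eqF.
  by exists (lift ord0 (Ordinal n0)); rewrite lift_eqF.
have [[si siE] [sl slE]] := (bar_vertex i, bar_vertex l).
have [g gP fE] := polyfun_div_proj (si - sl) (polyfun_bar i) fP.
exists g => // s; rewrite fE f0 ?add0r // -scaleNr bar_affine siE slE eqxx.
by rewrite [i == l]eq_sym (negbTE li) subr0 mulr1 subrr.
Qed.

(** Once bar_i has been divided out, the quotient still vanishes on each other
    facet l: through a point of that hyperplane and vertex i, which also lies in
    it, passes a line on which bar_i is not identically zero. *)
Lemma polyfun_div_bubble m (f : 'rV[R]_n -> R) (r : seq 'I_n.+1) :
  (0 < n)%N -> uniq r -> polyfun m f ->
  (forall i s, i \in r -> bar s i = 0 -> f s = 0) ->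
  exists2 g, polyfun (m - size r) g &
    forall s, f s = (\prod_(i <- r) bar s i) * g s.
Proof.
move=> n0; elim: r m f => [|i r IH] m f /=.
  by move=> _ fP _; exists f => [|s]; rewrite ?subn0 // big_nil mul1r.
move=> /andP[ir ur] fP f0.
have [|g gP fE] := polyfun_div_bar (i := i) n0 fP.
  by move=> s; apply: f0; rewrite mem_head.
have [|h hP gE] := IH _ _ ur gP.
  move=> l s lr sl.
  have li : l != i by apply: contraNneq ir => <-.
  have [si siE] := bar_vertex i.
  have -> : s = si + 1 *: (s - si) by rewrite scale1r addrC subrK.
  apply: (polyfun_cancel (polyfun_bar i) gP) => [|t].
    by rewrite siE eqxx oner_neq0.
  rewrite -fE; apply: (f0 l); first by rewrite inE lr orbT.
  by rewrite bar_affine siE (negbTE li) sl subrr mulr0 addr0.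
exists h; first by rewrite -subn1 -subnDA add1n in hP *.
by move=> s; rewrite big_cons fE gE mulrA.
Qed.

(** At this distance from the centre each coordinate lies strictly between 0 and
    1/(n + 1), so that their sum stays below 1: the ball is contained in the
    interior of the standard simplex. *)
Definition simplex_center : 'rV[R]_n := const_mx (2 * n.+1%:R)^-1.
Definition simplex_radius : R := (2 * n.+1%:R)^-1.

Lemma simplex_radius_gt0 : 0 < simplex_radius.
Proof. by rewrite invr_gt0 mulr_gt0. Qed.

Lemma bar_gt0 s i : ball simplex_center simplex_radius s -> 0 < bar s i.
Proof.
move=> /(ball_row _ _ simplex_radius_gt0) sP.
have {}sP j : 0 < s 0 j < n.+1%:R^-1.
  have := sP j; rewrite /ball /= mxE -/simplex_radius => h.
  have -> : n.+1%:R^-1 = simplex_radius + simplex_radius.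
    have : n.+1%:R != 0 :> R by rewrite pnatr_eq0.
    by rewrite /simplex_radius; move: (n.+1%:R) => N N0; field.
  by move: h; rewrite distrC ltr_distl subrr.
case: (unliftP ord0 i) => [j|] ->; first by rewrite bar_lift; case/andP: (sP j).
rewrite bar0 subr_gt0 (@le_lt_trans _ _ (\sum_(j < n) n.+1%:R^-1)) //.
  by apply: ler_sum => j _; case/andP: (sP j) => _ /ltW.
rewrite sumr_const card_ord -[X in X < _]mulr_natr mulrC ltr_pdivrMr ?ltr0n //.
by rewrite mul1r ltr_nat.
Qed.

Lemma std_simplexP s : std_simplex s <-> forall i, 0 <= bar s i.
Proof.
split=> [[s0 s1] i|sP].
  by case: (unliftP ord0 i) => [j|] ->; rewrite ?bar_lift // bar0 subr_ge0.
by split=> [j|]; [rewrite -bar_lift|rewrite -subr_ge0 -bar0].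
Qed.

End Barycentric.

Lemma dotE (R : realType) n (u v : 'rV[R]_n) : dot u v = \sum_i u 0 i * v 0 i.
Proof. by rewrite /dot mxE; apply: eq_bigr => i _; rewrite mxE. Qed.

Lemma dotDl (R : realType) n (u v z : 'rV[R]_n) :
  dot (u + v) z = dot u z + dot v z.
Proof. by rewrite /dot mulmxDl mxE. Qed.

Lemma dotDr (R : realType) n (u v z : 'rV[R]_n) :
  dot u (v + z) = dot u v + dot u z.
Proof. by rewrite /dot linearD mulmxDr mxE. Qed.

Lemma dotZl (R : realType) n a (u v : 'rV[R]_n) : dot (a *: u) v = a * dot u v.
Proof. by rewrite /dot -scalemxAl mxE. Qed.

Lemma dotZr (R : realType) n a (u v : 'rV[R]_n) : dot u (a *: v) = a * dot u v.
Proof. by rewrite /dot linearZ /= -scalemxAr mxE. Qed.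

Lemma dotNr (R : realType) n (u v : 'rV[R]_n) : dot u (- v) = - dot u v.
Proof. by rewrite -scaleN1r dotZr mulN1r. Qed.

Lemma dotBr (R : realType) n (u v z : 'rV[R]_n) :
  dot u (v - z) = dot u v - dot u z.
Proof. by rewrite dotDr dotNr. Qed.

Lemma dot0l (R : realType) n (v : 'rV[R]_n) : dot 0 v = 0.
Proof. by rewrite /dot mul0mx mxE. Qed.

Lemma dot0r (R : realType) n (v : 'rV[R]_n) : dot v 0 = 0.
Proof. by rewrite /dot trmx0 mulmx0 mxE. Qed.

Lemma dot_suml (R : realType) n (I : Type) (r : seq I) (P : pred I)
    (F : I -> 'rV[R]_n) v :
  dot (\sum_(i <- r | P i) F i) v = \sum_(i <- r | P i) dot (F i) v.
Proof.
by elim/big_rec2: _ => [|i y1 y2 _ <-]; [exact: dot0l|rewrite dotDl].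
Qed.

Lemma dot_sumr (R : realType) n (I : Type) (r : seq I) (P : pred I)
    (F : I -> 'rV[R]_n) v :
  dot v (\sum_(i <- r | P i) F i) = \sum_(i <- r | P i) dot v (F i).
Proof.
by elim/big_rec2: _ => [|i y1 y2 _ <-]; [exact: dot0r|rewrite dotDr].
Qed.

Lemma dot_ge0 (R : realType) n (v : 'rV[R]_n) : 0 <= dot v v.
Proof. by rewrite dotE sumr_ge0 // => i _; rewrite -expr2 sqr_ge0. Qed.

Lemma dot_eq0 (R : realType) n (v : 'rV[R]_n) : dot v v = 0 -> v = 0.
Proof.
rewrite dotE => /eqP; rewrite psumr_eq0 => [/allP v0|i _].
  apply/rowP => i; apply/eqP; rewrite mxE.
  by have := v0 i (mem_index_enum _); rewrite /= -expr2 sqrf_eq0.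
by rewrite -expr2 sqr_ge0.
Qed.

(** A Gram matrix of independent vectors is joined to the identity by a segment
   of positive definite matrices, on which the determinant cannot vanish. *)
Lemma gram_gt0 (R : realType) n (J : 'M[R]_(n, 4)) :
  (forall v : 'rV_n, v *m J = 0 -> v = 0) -> 0 < gram J.
Proof.
move=> Jfree; rewrite sqrtr_gt0.
pose P : 'M[{poly R}]_n := map_mx polyC (J *m J^T) +
  ('X *: (map_mx polyC (1%:M - J *m J^T))).
have PE t : (\det P).[t] = \det (J *m J^T + t *: (1%:M - J *m J^T)).
  rewrite -[LHS]/(horner_eval t _) -det_map_mx; congr (\det _).
  apply/matrixP => i j; rewrite /P !mxE /=.
  by rewrite /horner_eval hornerD hornerM hornerX !hornerC.
have Pn0 t : 0 <= t <= 1 -> (\det P).[t] != 0.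
  move=> /andP[t0 t1]; rewrite PE; apply/negP => /det0P[v vn0 vP].
  have : dot v v * t + dot (v *m J) (v *m J) * (1 - t) = 0.
    have vG : dot (v *m (J *m J^T)) v = dot (v *m J) (v *m J).
      by rewrite /dot trmx_mul !mulmxA.
    have := dot0l v; rewrite -vP mulmxDr -scalemxAr mulmxBr mulmx1.
    by rewrite dotDl dotZl -scaleN1r dotDl dotZl vG => <-; ring.
  move/eqP; rewrite paddr_eq0 ?mulr_ge0 ?dot_ge0 ?subr_ge0 //.
  rewrite !mulf_eq0 => /andP[/orP[/eqP/dot_eq0 v0|/eqP t00]].
    by rewrite v0 eqxx in vn0.
  rewrite t00 subr0 oner_eq0 orbF => /eqP/dot_eq0/Jfree v0.
  by rewrite v0 eqxx in vn0.
have P1 : (\det P).[1] = 1 by rewrite PE scale1r addrC subrK det1.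
have P0 : (\det P).[0] = \det (J *m J^T) by rewrite PE scale0r addr0.
rewrite -P0 ltNge; apply/negP => P0le.
have [|t tI] := poly_ivt (ler01 : 0 <= 1 :> R) (p := \det P).
  by rewrite P0le P1 ler01.
by rewrite rootE (negbTE (Pn0 _ _)) // -in_itv.
Qed.

(** * Polynomial spaces and expansions in the last variable *)

Section Conversions.
Variables (R : realType) (n : nat).

Lemma polyfun_prodX (e : 'I_n -> nat) (r : seq 'I_n) :
  polyfun (\sum_(i <- r) e i).+1
    (fun s : 'rV[R]_n => \prod_(i <- r) s 0 i ^+ e i).
Proof.
elim: r => [|i r IH].
  rewrite big_nil; apply: polyfun_ext (polyfun_cst n 0 1) => s.
  by rewrite big_nil.
apply: (@polyfun_ext _ _ _ (fun s : 'rV[R]_n =>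
  s 0 i ^+ e i * \prod_(j <- r) s 0 j ^+ e j)) => [s|]; first by rewrite big_cons.
rewrite big_cons -addnS; elim: (e i) => [|d IHd].
  by apply: polyfun_ext IH => s; rewrite expr0 mul1r.
rewrite addSn; apply: polyfun_ext (polyfunMX i IHd) => s.
by rewrite exprS mulrA.
Qed.

Lemma polyfun_meval m (p : mpoly n R) : (msize p <= m)%N ->
  polyfun m (fun s : 'rV[R]_n => meval (fun i => s 0 i) p).
Proof.
move=> pm; apply: polyfun_ext (_ : polyfun m (fun s : 'rV[R]_n =>
  \sum_(d <- msupp p) (if (mdeg d < m)%N then
     mcoeff d p * \prod_i s 0 i ^+ d i else 0))).
  move=> s; rewrite mevalE; apply: eq_big_seq => d dp.
  by rewrite (leq_trans (msize_mdeg_lt dp) pm).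
apply: polyfun_sum => d _; case: (mdeg d < m)%N /idP => [dm|_]; last exact: polyfun0.
apply: polyfunZ; apply: (polyfun_leq dm).
by have := polyfun_prodX d (index_enum 'I_n); rewrite -mdegE.
Qed.

Lemma Ppoly_polyfun m j (f : 'rV[R]_n -> R) : j + 1 <= m%:Z -> Ppoly j f ->
  polyfun m f.
Proof.
move=> jm [p [pj fE]]; apply: polyfun_ext (polyfun_meval (p := p) _) => [s|].
  by rewrite fE.
case: pj => [->|pj]; first by rewrite msize0.
by rewrite -lez_nat (le_trans pj jm).
Qed.

Lemma Phomog_polyfun j (f : 'rV[R]_n -> R) : Phomog j f -> polyfun j.+1 f.
Proof.
move=> [p [/dhomogP ph fE]]; apply: polyfun_ext (polyfun_meval (p := p) _).
  by move=> s; rewrite fE.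
rewrite msizeE; apply/bigmax_leqP_seq => d dp _.
by rewrite ltnS (ph _ dp).
Qed.

Lemma polyfun_mpoly m (f : 'rV[R]_n -> R) : polyfun m f ->
  exists2 p : mpoly n R, (msize p <= m)%N &
    forall s, f s = meval (fun i => s 0 i) p.
Proof.
elim: m f => [|m IH] f /=.
  by move=> f0; exists 0 => [|s]; rewrite ?msize0 // f0 meval0.
move=> [c [g [gP fE]]].
have /choice[p pP] : forall i, exists p : mpoly n R,
    (msize p <= m)%N /\ forall s, g i s = meval (fun i => s 0 i) p.
  by move=> i; have [p ? ?] := IH _ (gP i); exists p.
exists (mpolyC n c + \sum_i mpolyX R (mnm1 i) * p i).
  apply: leq_trans (msizeD_le _ _) _; rewrite geq_max msizeC.
  rewrite (leq_trans (leq_b1 _)) //=.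
  apply: leq_trans (msize_sum _ _ _) _; apply/bigmax_leqP => i _.
  have [->|p0] := eqVneq (p i) 0; first by rewrite mulr0 msize0.
  rewrite msizeM // ?msizeX ?mdeg1 ?add2n //=; first by case: (pP i).
  by rewrite -msize_poly_eq0 msizeX.
move=> s; rewrite fE mevalD mevalC raddf_sum /=; congr (_ + _).
by apply: eq_bigr => i _; rewrite mevalM mevalXU (pP i).2.
Qed.

Lemma polyfun_Ppoly m j (f : 'rV[R]_n -> R) :
  m%:Z <= j + 1 \/ m = 0%N -> polyfun m f -> Ppoly j f.
Proof.
move=> mj /polyfun_mpoly[p pm fE]; exists p; split=> //.
case: mj pm => [mj|->] pm; first by right; rewrite (le_trans _ mj) // lez_nat.
by left; apply/eqP; rewrite -msize_poly_eq0 -leqn0.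
Qed.

End Conversions.

Section Nedelec.
Variable R : realType.

(** This is the Nedelec space in the form in which it is used: fields of degree
    less than m whose product with the position vector has no larger degree. *)
Definition ned m (u : 'rV[R]_3 -> 'rV[R]_3) :=
  (forall i, polyfun m (fun y => u y 0 i)) /\
  polyfun m (fun y => dot (u y) y).

(** The homogeneous part of top degree is orthogonal to y and drops out of the
    product with y. *)
Lemma nedelec_ned k u : nedelec k u -> ned k.+2 u.
Proof.
move=> [p [h [pP hP hy uE]]].
have {}pP i : polyfun k.+1 (fun y => p y 0 i).
  by apply: Ppoly_polyfun (pP i); lia.
split=> [i|].
  apply: (@polyfun_ext _ _ _ (fun y => p y 0 i + h y 0 i)) => [y|].
    by rewrite uE mxE.
  by apply: polyfunD; [exact/polyfunS/pP|exact: Phomog_polyfun].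
apply: (@polyfun_ext _ _ _ (fun y => \sum_i y 0 i * p y 0 i)) => [y|].
  rewrite uE dotDl hy addr0 dotE; apply: eq_bigr => i _; exact: mulrC.
by apply: polyfun_sum => i _; exact: polyfunMX.
Qed.

Lemma ned0 m : ned m (fun=> 0).
Proof.
split=> [i|]; apply: polyfun_ext (polyfun0 _ _ m) => y; first by rewrite mxE.
by rewrite dot0l.
Qed.

Lemma nedD m u v : ned m u -> ned m v -> ned m (fun y => u y + v y).
Proof.
move=> [uP uyP] [vP vyP]; split=> [i|].
  by apply: polyfun_ext (polyfunD (uP i) (vP i)) => y; rewrite mxE.
by apply: polyfun_ext (polyfunD uyP vyP) => y; rewrite dotDl.
Qed.

Lemma nedZ m a u : ned m u -> ned m (fun y => a *: u y).
Proof.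
move=> [uP uyP]; split=> [i|].
  by apply: polyfun_ext (polyfunZ a (uP i)) => y; rewrite mxE.
by apply: polyfun_ext (polyfunZ a uyP) => y; rewrite dotZl.
Qed.

Lemma ned_dot m u (v : 'rV[R]_3) : ned m u ->
  polyfun m (fun y => dot (u y) (v - y)).
Proof.
move=> [uP uyP].
apply: (@polyfun_ext _ _ _ (fun y => \sum_i v 0 i * u y 0 i - dot (u y) y)).
  by move=> y; rewrite dotBr [dot _ v]dotE; congr (_ - _); apply: eq_bigr => i _;
    exact: mulrC.
by apply: polyfunB => //; apply: polyfun_sum => i _; apply: polyfunZ.
Qed.

End Nedelec.

Section TimeExpansion.
Variable R : realType.

Definition lincomb_closed (V : lmodType R) (S : ('rV[R]_3 -> V) -> Prop) :=
  [/\ S (fun=> 0), (forall f g, S f -> S g -> S (fun y => f y + g y)) &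
      (forall a f, S f -> S (fun y => a *: f y))].

Lemma lincomb_closed_sum (V : lmodType R) (S : ('rV[R]_3 -> V) -> Prop) (N : nat)
    (c : 'I_N -> R) (a : 'I_N -> 'rV[R]_3 -> V) :
  lincomb_closed S -> (forall i, S (a i)) ->
  S (fun y => \sum_i c i *: a i y).
Proof.
move=> [S0 SD SZ] aS.
suff H (r : seq 'I_N) : S (fun y => \sum_(i <- r) c i *: a i y) by exact: H.
elim: r => [|i r IH].
  by rewrite (_ : (fun _ => _) = fun=> 0) //; apply/funext => y; rewrite big_nil.
rewrite (_ : (fun _ => _) = fun y => c i *: a i y + \sum_(i <- r) c i *: a i y).
  by apply: SD => //; apply: SZ.
by apply/funext => y; rewrite big_cons.
Qed.

(** Collecting the powers of t leaves unique coefficients, to which pointwise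
    statements in t can be transferred. *)
Lemma tprod_expand (V : lmodType R) j N (W : set ('rV[R]_3 -> V))
    (S : ('rV[R]_3 -> V) -> Prop) f :
  lincomb_closed S -> (forall g, W g -> S g) -> j + 1 <= N%:Z ->
  tprod (P1poly j) W f ->
  exists a : nat -> 'rV[R]_3 -> V, (forall i, S (a i)) /\
    forall x, f x = \sum_(i < N) x4 x ^+ i *: a i (ypart x).
Proof.
move=> Scl WS jN [m [a [b [abP fE]]]].
have /choice[p pP] : forall i, exists p : {poly R},
    (size p <= N)%N /\ forall t, a i t = p.[t].
  move=> i; have [[p [pj aE]] _] := abP i; exists p; split=> //.
  case: pj => [->|pj]; first by rewrite size_poly0.
  by rewrite -lez_nat (le_trans pj jN).
exists (fun j y => \sum_(i < m) (p i)`_j *: b i y); split=> [l|x].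
  by apply: lincomb_closed_sum => // i; apply: WS; case: (abP i).
rewrite fE; under [RHS]eq_bigr do rewrite scaler_sumr.
rewrite exchange_big; apply: eq_bigr => i _ /=.
have [szp ->] := pP i; rewrite (horner_coef_wide _ szp) scaler_suml.
by apply: eq_bigr => l _; rewrite scalerA mulrC.
Qed.

Lemma tprod_sum (W : set ('rV[R]_3 -> R)) j N (a : nat -> 'rV[R]_3 -> R) :
  N%:Z <= j + 1 \/ N = 0%N -> (forall i, W (a i)) ->
  tprodS (P1poly j) W (fun x => \sum_(i < N) x4 x ^+ i * a i (ypart x)).
Proof.
move=> Nj aW; exists N, (fun i t => t ^+ i), (fun i => a i); split=> // i.
split=> //; exists 'X^i; split=> [|t]; last by rewrite hornerXn.
case: Nj i => [Nj i|-> [//]]; right.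
by rewrite size_polyXn (le_trans _ Nj) // lez_nat.
Qed.

(** The coefficients of the quotients of t^i by bub1 do not depend on the
    coefficients of the polynomial that is divided.  Hence the quotient of a
    polynomial with coefficients in a vector space has coefficients in the
    linear span of the given ones; in particular Nedelec fields stay Nedelec
    fields.  The remainder has degree at most one in t and two zeros. *)
Lemma bub1_division N : exists M : nat -> nat -> R,
  forall (V : lmodType R) (a : nat -> V),
  (forall t, t = -1 \/ t = 1 -> \sum_(i < N) t ^+ i *: a i = 0) ->
  forall t, \sum_(i < N) t ^+ i *: a i =
    bub1 t *: \sum_(j < N - 2) t ^+ j *: \sum_(i < N) M j i *: a i.
Proof.
pose D : {poly R} := 'X^2 - 1.
have szD : size D = 3 by rewrite size_XnsubC.
have D0 : D != 0 by rewrite -size_poly_eq0 szD.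
pose Q i : {poly R} := 'X^i %/ D; pose r i : {poly R} := 'X^i %% D.
have szQ i : (i < N)%N -> (size (Q i) <= N - 2)%N.
  by move=> iN; rewrite size_divp // size_polyXn szD; lia.
have szr i : (size (r i) <= 2)%N by rewrite -ltnS -[X in (_ < X)%N]szD ltn_modp.
have QrE i t : t ^+ i = (Q i).[t] * (t ^+ 2 - 1) + ((r i)`_0 + (r i)`_1 * t).
  rewrite -(hornerXn t i) {1}(divp_eq 'X^i D) hornerD hornerM.
  rewrite [in X in _ * X]hornerD hornerXn hornerN hornerC; congr (_ + _).
  by rewrite (horner_coef_wide _ (szr i)) !big_ord_recl big_ord0 addr0 expr0 mulr1 expr1.
(* bub1 is - (t^2 - 1) / 4 *)
exists (fun j i => -4 * (Q i)`_j) => V a a0 t.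
pose b := \sum_(i < N) (r i)`_0 *: a i; pose c := \sum_(i < N) (r i)`_1 *: a i.
have aE u : \sum_(i < N) u ^+ i *: a i =
    (u ^+ 2 - 1) *: (\sum_(i < N) (Q i).[u] *: a i) + (b + u *: c).
  rewrite /b /c !scaler_sumr -!big_split /=; apply: eq_bigr => i _.
  by rewrite {1}QrE !scalerA -!scalerDl; congr (_ *: _); ring.
have bc0 : b = 0 /\ c = 0.
  have := a0 1 (or_intror erefl); have := a0 (-1) (or_introl erefl).
  rewrite !aE sqrrN expr1n subrr !scale0r !add0r scale1r scaleN1r.
  move=> /eqP; rewrite subr_eq0 => /eqP ->; rewrite -mulr2n => /eqP.
  rewrite -scaler_nat scaler_eq0 pnatr_eq0 /= => /eqP ->.
  by [].
case: bc0 => b0 c0; rewrite aE b0 c0 scaler0 !addr0.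
have -> : \sum_(j < N - 2) t ^+ j *: (\sum_(i < N) (-4 * (Q i)`_j) *: a i) =
    -4 *: \sum_(i < N) (Q i).[t] *: a i.
  under eq_bigr do rewrite scaler_sumr.
  rewrite exchange_big scaler_sumr; apply: eq_bigr => i _ /=.
  rewrite (horner_coef_wide _ (szQ i (ltn_ord i))) scaler_suml scaler_sumr.
  by apply: eq_bigr => j _; rewrite !scalerA; congr (_ *: _); ring.
rewrite scalerA; congr (_ *: _); rewrite /bub1 /nu1 /nu2; by field.
Qed.

Lemma time_coef_eq0 N (c : nat -> R) e : 0 < e ->
  (forall t, `|t| < e -> \sum_(i < N) t ^+ i * c i = 0) ->
  forall i, (i < N)%N -> c i = 0.
Proof.
move=> e0 h i iN.
have p0 : \poly_(i < N) c i = 0.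
  apply: (horner_eq0_near0 e0) => t te; rewrite horner_poly -[RHS](h t te).
  by apply: eq_bigr => j _; rewrite mulrC.
by have := congr1 (fun p : {poly R} => p`_i) p0; rewrite coef_poly iN coef0.
Qed.

End TimeExpansion.

(** * The tetrahedron, its faces and their cells *)

Section Geometry.
Variable R : realType.
Implicit Types (y a b : 'rV[R]_3) (t : R).
Local Notation vtx := (@vtx R).

Lemma ypart_pt y t : ypart (pt y t) = y.
Proof. exact: row_mxKl. Qed.

Lemma x4_pt y t : x4 (pt y t) = t.
Proof.
rewrite /x4 /pt (_ : ord_max = rshift 3 (0 : 'I_1)); last exact: val_inj.
by apply: etrans (row_mxEr y t%:M 0 0) _; rewrite mxE eqxx mulr1n.
Qed.

Lemma ptK (x : 'rV[R]_4) : pt (ypart x) (x4 x) = x.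
Proof.
apply: etrans (@hsubmxK R 1 3 1 x); congr (row_mx _ _).
apply/rowP => i; rewrite ord1 !mxE eqxx mulr1n /x4.
by congr (fun_of_matrix x 0 _); exact: val_inj.
Qed.

Lemma dot_pt a b s t : dot (pt a s) (pt b t) = dot a b + s * t.
Proof.
have dE : pt a s *m (pt b t)^T = a *m b^T + s%:M *m (t%:M)^T.
  by rewrite -mul_row_col -tr_row_mx.
rewrite /dot dE mxE; congr (_ + _).
by rewrite tr_scalar_mx -scalar_mxM mxE eqxx mulr1n.
Qed.

Lemma ptD a b s t : pt (a + b) (s + t) = pt a s + pt b t.
Proof. by rewrite /pt raddfD -add_row_mx. Qed.

Lemma ptZ c a s : pt (c *: a) (c * s) = c *: pt a s.
Proof. by rewrite /pt -scale_scalar_mx -scale_row_mx. Qed.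

Lemma pt00 : pt 0 0 = 0 :> 'rV[R]_4.
Proof. by rewrite /pt raddf0 row_mx0. Qed.

Lemma pt_sum (I : Type) (r : seq I) (P : pred I) (c : I -> R)
    (F : I -> 'rV[R]_3) :
  \sum_(i <- r | P i) c i *: pt (F i) 0 = pt (\sum_(i <- r | P i) c i *: F i) 0.
Proof.
elim/big_rec2: _ => [|i u v _ ->]; first by rewrite pt00.
by rewrite -ptZ -ptD mulr0 addr0.
Qed.

(** The j-th component of the gradient of the i-th barycentric coordinate. *)
Definition glam (i : 'I_4) (j : 'I_3) : R :=
  if unlift ord_max i is Some l then 2^-1 * (l == j)%:R else - 2^-1.

Lemma grad_lamE i y j : grad_lam i y 0 j = glam i j.
Proof.
have dX (l : 'I_3) : meval (fun m => y 0 m) (mderiv j (mpolyX R (mnm1 l))) =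
    (l == j)%:R.
  rewrite mderivX mevalZ mnm1E; have [->|_] := eqVneq l j; last by rewrite mul0r.
  by rewrite mul1r mevalX big1 // => i0 _; rewrite mnmBE subnn.
rewrite mxE /lamp /glam; case: unlift => [l|].
  by rewrite mderivZ mevalZ mderivD mderivC add0r dX.
rewrite mderivN mderivZ mevalN mevalZ mderivD mderivC add0r.
have d0 : mderiv j (0 : mpoly 3 R) = 0 by rewrite -(mpolyC0 3 R) mderivC.
rewrite (big_morph (mderiv j) (mderivD j) d0).
rewrite raddf_sum /= (bigD1 j) //= dX eqxx big1 ?addr0 ?mulr1 //.
by move=> l /negbTE lj; rewrite dX lj.
Qed.

Lemma lamE i y : lam i y = lam i 0 + \sum_j glam i j * y 0 j.
Proof.
rewrite /lam /lamp /glam; case: unlift => [l|].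
  rewrite !mevalZ !mevalD !meval1 !mevalXU mxE addr0 mulrDr; congr (_ + _).
  rewrite (bigD1 l) //= eqxx mulr1 big1 ?addr0 // => j /negbTE lj.
  by rewrite eq_sym lj mulr0 mul0r.
rewrite !mevalN !mevalZ !mevalD !meval1 !raddf_sum /= -mulr_sumr.
rewrite [X in _ = - (_ * (_ + X)) + _]big1 => [|j _]; last by rewrite mevalXU mxE.
under eq_bigr do rewrite mevalXU.
by ring.
Qed.

Lemma lam_comb i n (c : 'I_n -> R) (p : 'I_n -> 'rV[R]_3) : \sum_l c l = 1 ->
  lam i (\sum_l c l *: p l) = \sum_l c l * lam i (p l).
Proof.
move=> c1; under [RHS]eq_bigr do rewrite lamE mulrDr.
rewrite lamE big_split /= -mulr_suml c1 mul1r; congr (_ + _).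
under [RHS]eq_bigr do rewrite mulr_sumr.
rewrite exchange_big; apply: eq_bigr => j _ /=.
rewrite summxE mulr_sumr; apply: eq_bigr => l _; rewrite mxE; ring.
Qed.

Lemma polyfun_lam i : polyfun 2 (@lam R i).
Proof.
apply: (@polyfun_ext _ _ _ (fun y => lam i 0 + \sum_j glam i j * y 0 j)).
  by move=> y; rewrite -lamE.
apply: polyfunD; first exact: polyfun_cst.
by apply: polyfun_sum => j _; apply/polyfunZ/polyfun_coord.
Qed.

Lemma glam_sum (f : 'I_4 -> R) j :
  \sum_l f l * glam l j = (f (lift ord_max j) - f ord_max) / 2.
Proof.
rewrite (bigD1_ord ord_max) //= /glam unlift_none (bigD1 j) //= liftK eqxx.
rewrite big1 => [|l /negbTE lj]; first by rewrite mulr1; field.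
by rewrite liftK lj !mulr0.
Qed.

Lemma vtx_liftB j i :
  (vtx (lift ord_max j) - vtx ord_max) 0 i = 2 * (i == j)%:R.
Proof.
have bE : bump 3 j = j by rewrite /bump leqNgt ltn_ord add0n.
rewrite !mxE /= bE [(3 == i)%N]gtn_eqF // eq_sym -val_eqE /=.
by case: (_ == _) => /=; ring.
Qed.

(** The gradients of the barycentric coordinates are dual to the edge vectors,
    so a vector is determined by its products with the edges; the reference
    point y drops out because these gradients add up to zero. *)
Lemma grad_expansion y a : a = \sum_l dot a (vtx l - y) *: grad_lam l y.
Proof.
apply/rowP => j; rewrite summxE.
under eq_bigr do rewrite mxE grad_lamE.
rewrite glam_sum -dotBr opprB addrA subrK dotE (bigD1 j) //= big1 => [|i ij].
  by rewrite vtx_liftB eqxx mulr1; field.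
by rewrite vtx_liftB (negbTE ij) !mulr0.
Qed.

Lemma sum_lam y : \sum_l lam l y = 1.
Proof.
under eq_bigr do rewrite lamE.
rewrite big_split /= exchange_big /= [X in _ + X]big1 => [|j _].
  rewrite addr0 /lam /lamp (bigD1_ord ord_max) //= unlift_none.
  rewrite [X in _ + X](eq_bigr (fun=> 2^-1 : R)) => [|i _].
    rewrite sumr_const card_ord !mevalN !mevalZ !mevalD !meval1 raddf_sum /=.
    by rewrite big1 => [|i _]; rewrite ?mevalXU ?mxE //; field.
  by rewrite liftK mevalZ mevalD meval1 mevalXU mxE addr0 mulr1.
by rewrite -mulr_suml (eq_bigr (fun l => 1 * glam l j)) => [|l _];
  rewrite ?mul1r // glam_sum subrr !mul0r.
Qed.

Lemma lam_expansion y : \sum_l lam l y *: vtx l = y.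
Proof.
apply/rowP => j; rewrite summxE -[LHS]addr0 -[X in _ + X](subrr 1).
rewrite -{1}(sum_lam y) addrA -big_split /=.
rewrite (bigD1_ord (lift ord_max j)) //= big1 => [|l _].
  rewrite !mxE /= /bump leqNgt ltn_ord add0n eqxx lamE.
  rewrite (eq_bigr (fun i => 2^-1 * (j == i)%:R * y 0 i)) => [|i _].
    rewrite (bigD1 j) //= big1 => [|i /negbTE ij].
      rewrite eqxx /lam /lamp liftK mevalZ mevalD meval1 mevalXU mxE /= !mulr1.
      by field.
    by rewrite eq_sym ij mulr0 mul0r.
  by rewrite /glam liftK.
rewrite !mxE (_ : (_ == _ :> nat) = false); first by ring.
have := neq_lift (lift ord_max j) l; rewrite -val_eqE /= [bump 3 j]/bump.
by rewrite [(3 <= j)%N]leqNgt ltn_ord add0n eq_sym => /negbTE.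
Qed.

End Geometry.

Lemma row1_mul (R : realType) n (a : 'rV[R]_1) (u : 'rV[R]_n) :
  a *m u = a 0 0 *: u.
Proof.
rewrite {1}(_ : a = (a 0 0)%:M) ?mul_scalar_mx //.
by apply/rowP => i; rewrite ord1 [RHS]mxE eqxx.
Qed.

Section Faces.
Variables (R : realType) (n : nat) (w : 'I_n.+1 -> 'I_4).
Implicit Types (s : 'rV[R]_n) (y : 'rV[R]_3).

(** pos parametrizes the affine span of a face by the standard simplex, and loc
    is an affine left inverse of it, defined on the whole space.  Through loc
    polynomials on the parameter domain become test functions. *)
Definition pos s : 'rV[R]_3 := \sum_l bar s l *: @vtx R (w l).
Definition loc y : 'rV[R]_n := \row_j lam (w (lift ord0 j)) y.

Lemma polyfun_loc i : polyfun 2 (fun y => loc y 0 i).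
Proof.
by apply: polyfun_ext (polyfun_lam R (w (lift ord0 i))) => y; rewrite mxE.
Qed.

Lemma polyfun_pos i : polyfun 2 (fun s => pos s 0 i).
Proof.
apply: (@polyfun_ext _ _ _ (fun s => \sum_l vtx R (w l) 0 i * bar s l)) => [s|].
  by rewrite summxE; apply: eq_bigr => l _; rewrite [RHS]mxE mulrC.
by apply: polyfun_sum => l _; apply/polyfunZ/polyfun_bar.
Qed.

Lemma posE s : pos s = vtx R (w ord0) +
  \sum_j s 0 j *: (vtx R (w (lift ord0 j)) - vtx R (w ord0)).
Proof.
rewrite /pos big_ord_recl bar0 scalerBl scale1r -addrA; congr (_ + _).
rewrite (eq_bigr (fun j => s 0 j *: vtx R (w (lift ord0 j)))) => [|j _].
  rewrite addrC scaler_suml -sumrB; apply: eq_bigr => j _.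
  by rewrite scalerBr.
by rewrite bar_lift.
Qed.

Lemma fdirE s :
  s *m fdir R w = pt (\sum_j s 0 j *: (vtx R (w (lift ord0 j)) - vtx R (w ord0))) 0.
Proof.
rewrite -pt_sum mulmx_sum_row; apply: eq_bigr => j _.
by congr (_ *: _); apply/rowP => i; rewrite !mxE.
Qed.

Lemma cmap_hcell t s : cmap (hcell w t) s = pt (pos s) t.
Proof. by rewrite /cmap /= fdirE -ptD addr0 -posE. Qed.

Lemma cmap_vcell (x : 'rV[R]_(n + 1)) :
  cmap (vcell R w) x = pt (pos (lsubmx x)) (rsubmx x 0 0).
Proof.
rewrite /cmap /= -[in LHS](hsubmxK x) mul_row_col row1_mul fdirE addrA -ptD.
by rewrite addr0 -posE /e4 -ptZ -ptD scaler0 addr0 mulr1 add0r.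
Qed.

Hypothesis wface : is_face w.

Lemma face_inj : injective w.
Proof.
move=> i j ij; case: (ltngtP i j) => [lt|lt|/val_inj //].
  by have := wface lt; rewrite ij ltnn.
by have := wface lt; rewrite ij ltnn.
Qed.

Lemma lam_pos s l : lam (w l) (pos s) = bar s l.
Proof.
rewrite lam_comb ?sum_bar // (bigD1 l) //= lam_vtx eqxx mulr1 big1 ?addr0 //.
by move=> i il; rewrite lam_vtx (inj_eq face_inj) eq_sym (negbTE il) mulr0.
Qed.

Lemma pos_loc s : loc (pos s) = s.
Proof. by apply/rowP => j; rewrite mxE lam_pos bar_lift. Qed.

(** Otherwise two different parameters would give the same point, but loc
    recovers the parameter. *)
Lemma fdir_free s : s *m fdir R w = 0 -> s = 0.
Proof.
rewrite fdirE => /(congr1 (@ypart R)).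
rewrite ypart_pt -pt00 ypart_pt => s0.
have p0 (z : 'rV[R]_n) :
    \sum_j z 0 j *: (vtx R (w (lift ord0 j)) - vtx R (w ord0)) = 0 ->
    pos z = vtx R (w ord0) by rewrite posE => ->; rewrite addr0.
rewrite -[LHS]pos_loc -[RHS]pos_loc !p0 //.
by rewrite big1 // => j _; rewrite mxE scale0r.
Qed.

Lemma gram_hcell_gt0 t : 0 < gram (cdir (@hcell R n w t)).
Proof. exact/gram_gt0/fdir_free. Qed.

Lemma gram_vcell_gt0 : 0 < gram (cdir (vcell R w)).
Proof.
apply: gram_gt0 => v; rewrite -(hsubmxK v) mul_row_col.
rewrite row1_mul fdirE /e4 -ptZ -ptD mulr1 add0r => v0.
have v4 : rsubmx v 0 0 = 0 by have := congr1 (@x4 R) v0; rewrite x4_pt -pt00 x4_pt.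
have /fdir_free -> : lsubmx v *m fdir R w = 0.
  by rewrite fdirE -v0 v4 scaler0 addr0.
suff -> : rsubmx v = 0 by rewrite row_mx0.
by apply/rowP => i; rewrite ord1 v4 mxE.
Qed.

End Faces.

Lemma face_lift n (w : 'I_n.+2 -> 'I_4) (i : 'I_n.+2) : is_face w ->
  is_face (fun l : 'I_n.+1 => w (lift i l)).
Proof.
move=> wP a b ab; apply: wP; rewrite /= /bump; lia.
Qed.

Lemma pos_facet (R : realType) n (w : 'I_n.+2 -> 'I_4) (i : 'I_n.+2)
    (s : 'rV[R]_n.+1) :
  bar s i = 0 -> exists s', pos w s = pos (fun l : 'I_n.+1 => w (lift i l)) s'.
Proof.
move=> si; have [|s' s'E] := @bar_surj R n (fun l => bar s (lift i l)).
  by have := sum_bar s; rewrite (bigD1_ord i) //= si add0r.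
exists s'; rewrite /pos (bigD1_ord i) //= si scale0r add0r.
by apply: eq_bigr => l _; rewrite s'E.
Qed.

(** * Bubble representations and unisolvence on one face *)

Section Bubbles.
Variables (R : realType) (n : nat) (w : 'I_n.+1 -> 'I_4).
Implicit Types (s : 'rV[R]_n) (u : 'rV[R]_3 -> 'rV[R]_3).

(** For y in the span of the face, v_l - y is tangent to the face, so these
    functions encode the tangential trace of u. *)
Definition vdot u (l : 'I_n.+1) s : R :=
  dot (u (pos w s)) (vtx R (w l) - pos w s).

Definition tvanish u := forall s l, vdot u l s = 0.

Lemma polyfun_vdot m u l : ned m u -> polyfun m (vdot u l).
Proof. by move=> /(ned_dot (vtx R (w l)))/(polyfun_comp (polyfun_pos R w)). Qed.

Lemma sum_bar_vdot u s : \sum_l bar s l * vdot u l s = 0.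
Proof.
rewrite (eq_bigr (fun l => dot (u (pos w s)) (bar s l *: vtx R (w l) -
    bar s l *: pos w s))) => [|l _].
  by rewrite -dot_sumr sumrB -scaler_suml sum_bar scale1r subrr dot0r.
by rewrite -scalerBr dotZr.
Qed.

Lemma dot_comb u s (c : 'I_n.+1 -> R) : \sum_l c l = 0 ->
  dot (u (pos w s)) (\sum_l c l *: vtx R (w l)) = \sum_l c l * vdot u l s.
Proof.
move=> c0; rewrite dot_sumr /vdot [RHS](eq_bigr (fun l =>
    dot (u (pos w s)) (c l *: vtx R (w l)) - c l * dot (u (pos w s)) (pos w s))).
  by rewrite sumrB -mulr_suml c0 mul0r subr0.
by move=> l _; rewrite dotBr mulrBr dotZr.
Qed.

(** Write U_l for vdot u l and b_i for bar i.  On the facet b_i = 0 the vectors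
    v_l - y with l <> i are tangent to the facet; once the trace on the facets
    vanishes, b_i divides U_l.  Dividing by the n
    coordinates with index other than l lowers the degree by n.  Since
    sum b_l U_l is the product of all b_i times sum V_l, the V_l add up to zero
    wherever no b_i vanishes, hence everywhere. *)
Lemma ned_bubble m u : (0 < n)%N -> ned m u ->
  (forall i l s, bar s i = 0 -> l != i -> vdot u l s = 0) ->
  exists V : 'I_n.+1 -> 'rV[R]_n -> R,
    [/\ forall l, polyfun (m - n) (V l), forall s, \sum_l V l s = 0 &
        forall l s, vdot u l s = (\prod_(i | i != l) bar s i) * V l s].
Proof.
move=> n0 uP u0.
have /choice[V VP] : forall l, exists V, polyfun (m - n) V /\
    forall s, vdot u l s = (\prod_(i | i != l) bar s i) * V s.
  move=> l; pose r := [seq i <- index_enum 'I_n.+1 | i != l].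
  have rsz : size r = n.
    by rewrite size_filter -sum1_count sum1_card cardC1 card_ord.
  have [||g gP gE] := polyfun_div_bubble (r := r) n0 _ (polyfun_vdot l uP).
  - by rewrite filter_uniq ?index_enum_uniq.
  - by move=> i s; rewrite mem_filter eq_sym => /andP[il _] si; exact: (u0 i).
  by exists g; rewrite rsz in gP; split=> // s; rewrite gE big_filter.
exists V; split=> [l|s|l s]; [by case: (VP l)| |by case: (VP l)].
have VsP : polyfun (m - n) (fun s => \sum_l V l s).
  by apply: polyfun_sum => l _; case: (VP l).
apply: (polyfun_ball_eq0 VsP (simplex_radius_gt0 R n)) => {}s /bar_gt0 s0.
have p0 : \prod_i bar s i != 0 by apply/prodf_neq0 => i _; rewrite gt_eqF.
apply: (mulfI p0); rewrite mulr0 mulr_sumr -[RHS](sum_bar_vdot u s).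
apply: eq_bigr => l _; rewrite (VP l).2 mulrA; congr (_ * _).
by rewrite (bigD1 l).
Qed.

End Bubbles.

(** Positive definiteness of the moments: the shape to which all the moments are
    brought by a suitable choice of the test function. *)
Lemma definite_squares (R : realType) N
    (I : set 'rV[R]_N -> ('rV[R]_N -> R) -> \bar R) (L : finType)
    (D : set 'rV[R]_N) (c : 'rV[R]_N) (r g : R) (om v : L -> 'rV[R]_N -> R) :
  definite I -> 0 < r -> ball c r `<=` D -> 0 < g ->
  (forall l, continuous (om l)) -> (forall l, continuous (v l)) ->
  (forall l s, D s -> 0 <= om l s) -> (forall l s, ball c r s -> 0 < om l s) ->
  I D (fun s => (\sum_l om l s * v l s ^+ 2) * g) = 0%E ->
  forall l s, ball c r s -> v l s = 0.
Proof.
move=> Idef r0 cD g0 omc vc om0 omp I0 l s cs.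
have : (\sum_l om l s * v l s ^+ 2) * g = 0.
  apply: (Idef D (fun s => (\sum_l om l s * v l s ^+ 2) * g) c r) => //.
    move=> x; apply: (continuousM (t := fun=> g)); last exact: cst_continuous.
    apply: continuous_big_sum => i z.
    apply: (continuousM (t := fun s => v i s ^+ 2)); first exact: omc.
    by apply: (continuousM (t := v i)); exact: vc.
  move=> x Dx; rewrite mulr_ge0 ?(ltW g0) // sumr_ge0 // => i _.
  by rewrite mulr_ge0 ?sqr_ge0 ?om0.
move=> /eqP; rewrite mulf_eq0 (gt_eqF g0) orbF psumr_eq0 => [/allP s0|i _].
  have := s0 l (mem_index_enum _).
  by rewrite /= mulf_eq0 (gt_eqF (omp _ _ cs)) sqrf_eq0 => /eqP.
by rewrite mulr_ge0 ?sqr_ge0 ?om0 //; exact: cD.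
Qed.

Section Steps.
Variables (R : realType) (n : nat) (w : 'I_n.+1 -> 'I_4).

Lemma continuous_prod_bar N (phi : 'rV[R]_N -> 'rV[R]_n) (P : pred 'I_n.+1) :
  (forall i, polyfun 2 (fun x => phi x 0 i)) ->
  continuous (fun x => \prod_(i | P i) bar (phi x) i).
Proof.
move=> phiP.
suff H (r : seq 'I_n.+1) : continuous (fun x => \prod_(i <- r | P i) bar (phi x) i).
  exact: H.
elim: r => [|i r IH].
  rewrite (_ : (fun _ => _) = fun=> 1); first exact: cst_continuous.
  by apply/funext => x; rewrite big_nil.
rewrite (_ : (fun _ => _) = fun x =>
    (if P i then bar (phi x) i else 1) * \prod_(i <- r | P i) bar (phi x) i).
  move=> x; apply: continuousM; last exact: IH.
  case: (P i); last exact: cst_continuous.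
  exact: (polyfun_continuous (polyfun_comp phiP (polyfun_bar R i))).
by apply/funext => x; rewrite big_cons; case: (P i) => //; rewrite mul1r.
Qed.

Lemma ball_std_simplex :
  ball (simplex_center R n) (simplex_radius R n) `<=` @std_simplex R n.
Proof. by move=> s /bar_gt0 s0; apply/std_simplexP => i; exact: ltW. Qed.

(** The moment against sum V_l v_l is the integral of
    sum (prod_(i <> l) b_i) V_l^2. *)
Lemma tvanish_step (I : set 'rV[R]_n -> ('rV[R]_n -> R) -> \bar R) m u g :
  definite I -> (0 < n)%N -> 0 < g -> ned m u ->
  (forall i l (s : 'rV[R]_n), bar s i = 0 -> l != i -> vdot w u l s = 0) ->
  (forall W : 'I_n.+1 -> 'rV[R]_n -> R, (forall l, polyfun (m - n) (W l)) ->
     (forall s, \sum_l W l s = 0) ->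
     I (@std_simplex R n) (fun s => dot (u (pos w s))
       (\sum_l W l s *: vtx R (w l)) * g) = 0%E) ->
  tvanish w u.
Proof.
move=> Idef n0 g0 uP u0 Imoments.
have [V [VP V0 uV]] := ned_bubble n0 uP u0.
have Vball := definite_squares (v := V)
  (om := fun l s => \prod_(i | i != l) bar s i) Idef (simplex_radius_gt0 R n)
  ball_std_simplex g0.
suff Vz l s : V l s = 0 by move=> s l; rewrite uV Vz mulr0.
apply: (polyfun_ball_eq0 (VP l) (simplex_radius_gt0 R n)) => {}s.
apply: Vball.
- by move=> i; apply: continuous_prod_bar => j; exact: polyfun_coord.
- by move=> i; exact: polyfun_continuous (VP i).
- by move=> i z /std_simplexP z0; rewrite prodr_ge0.
- by move=> i z zb; rewrite prodr_gt0 // => j _; exact: bar_gt0.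
rewrite -(Imoments V) //; congr (I _ _); apply/funext => z; congr (_ * _).
rewrite dot_comb //; apply: eq_bigr => i _; rewrite uV; ring.
Qed.

Local Notation yy := (@lsubmx R 1 n 1).
Local Notation ht x := (@rsubmx R 1 n 1 x 0 0).

(** The ball of radius simplex_radius around this point lies in the product of
    the simplex with [-1, 1]. *)
Definition vcenter : 'rV[R]_(n + 1) := row_mx (simplex_center R n) 0.

Lemma ball_vcenter x : ball vcenter (simplex_radius R n) x <->
  ball (simplex_center R n) (simplex_radius R n) (yy x) /\
  `|ht x| < simplex_radius R n.
Proof.
have r0 := simplex_radius_gt0 R n.
have yE i : yy x 0 i = x 0 (lshift 1 i) by rewrite mxE.
have tE : ht x = x 0 (rshift n 0) by rewrite mxE.
have bE : (`|ht x| < simplex_radius R n) =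
    ball (vcenter 0 (rshift n 0)) (simplex_radius R n) (x 0 (rshift n 0)) :> Prop.
  by rewrite row_mxEr /ball /= [X in `|X - _|]mxE sub0r normrN tE.
rewrite bE !(ball_row _ _ r0); split=> [h|[h1 h2] i].
  split=> [i|]; last exact: h.
  by have := h (lshift 1 i); rewrite row_mxEl yE.
case: (split_ordP i) => j ->; last by rewrite ord1.
by rewrite row_mxEl -yE.
Qed.

Lemma simplex_radius_lt1 : simplex_radius R n < 1.
Proof. by rewrite invf_lt1 // -natrM ?ltr0n ?ltr1n //; lia. Qed.

Lemma ball_vcell : ball vcenter (simplex_radius R n) `<=` cdom (vcell R w).
Proof.
move=> x /ball_vcenter[/ball_std_simplex sx].
move=> /lt_trans/(_ simplex_radius_lt1); rewrite ltr_norml /=.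
by move=> /andP[/ltW-> /ltW->].
Qed.

Lemma polyfun_lsubmx i : polyfun 2 (fun x => yy x 0 i).
Proof.
by apply: polyfun_ext (polyfun_coord R (lshift 1 i)) => x; rewrite mxE.
Qed.

Lemma polyfun_rsubmx : polyfun 2 (fun x => ht x).
Proof.
by apply: polyfun_ext (polyfun_coord R (rshift n (0 : 'I_1))) => x; rewrite mxE.
Qed.

Lemma continuous_time_sum N m (c : nat -> 'rV[R]_n -> R) :
  (forall j, polyfun m (c j)) ->
  continuous (fun x => \sum_(j < N) ht x ^+ j * c j (yy x)).
Proof.
move=> cP; apply: continuous_big_sum => j x.
apply: (continuousM (s := fun x => ht x ^+ j) (t := fun x => c j (yy x))).
  apply: (@continuous_comp _ _ _ (fun x => ht x) (fun t => t ^+ j)).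
    exact: polyfun_continuous polyfun_rsubmx _.
  exact: exprn_continuous.
exact: (polyfun_continuous (polyfun_comp polyfun_lsubmx (cP j))).
Qed.

Lemma bub1_gt0 (t : R) : `|t| < 1 -> 0 < bub1 t.
Proof.
rewrite ltr_norml => /andP[t1 t2]; rewrite /bub1 /nu1 /nu2.
by rewrite mulr_gt0 // divr_gt0 //; lra.
Qed.

Lemma bub1_ge0 (t : R) : -1 <= t <= 1 -> 0 <= bub1 t.
Proof.
move=> /andP[t1 t2]; rewrite /bub1 /nu1 /nu2.
by rewrite mulr_ge0 // divr_ge0 //; lra.
Qed.

Lemma continuous_bub1 : continuous (fun x => bub1 (ht x)).
Proof.
apply: polyfun_continuous 3 _ _.
rewrite /bub1 /nu1 /nu2; apply: polyfunM_aff.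
  apply: (@polyfun_ext _ _ _ (fun x => 2^-1 * (1 - ht x))) => [x|].
    exact: mulrC.
  apply: polyfunZ; apply: polyfunB; first exact: polyfun_cst.
  exact: polyfun_rsubmx.
apply: (@polyfun_ext _ _ _ (fun x => 2^-1 * (1 + ht x))) => [x|].
  exact: mulrC.
apply: polyfunZ; apply: polyfunD; first exact: polyfun_cst.
exact: polyfun_rsubmx.
Qed.

(** For fixed s a polynomial in t with zeros near 0 has zero coefficients, and
    each coefficient is a polynomial in s. *)
Lemma time_ball_eq0 N m (c : nat -> 'rV[R]_n -> R) :
  (forall j, polyfun m (c j)) ->
  (forall x, ball vcenter (simplex_radius R n) x ->
     \sum_(j < N) ht x ^+ j * c j (yy x) = 0) ->
  forall j s, (j < N)%N -> c j s = 0.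
Proof.
move=> cP c0 j s jN.
apply: (polyfun_ball_eq0 (c := simplex_center R n) (cP j)
  (simplex_radius_gt0 R n)) => {}s sb.
apply: (time_coef_eq0 (simplex_radius_gt0 R n) (N := N)
  (c := fun j => c j s)) => // t tr.
have := c0 (row_mx s t%:M); rewrite row_mxKl row_mxKr mxE eqxx mulr1n; apply.
by apply/ball_vcenter; rewrite row_mxKl row_mxKr mxE eqxx mulr1n.
Qed.

(** The version of tvanish_step on F x [-1, 1] for all the coefficients in t at
    once.  The test field has coefficients V_l(s, t) = sum_j t^j V_l^j(s), and
    the moment is the integral of
    bub1(t) sum_l (prod_(i <> l) b_i) V_l(s, t)^2. *)
Lemma tvanish_time_step (I : set 'rV[R]_(n + 1) -> _ -> \bar R) m N
    (a : nat -> 'rV[R]_3 -> 'rV[R]_3) g :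
  definite I -> (0 < n)%N -> 0 < g -> (forall j, ned m (a j)) ->
  (forall j i l (s : 'rV[R]_n), bar s i = 0 -> l != i -> vdot w (a j) l s = 0) ->
  (forall W : nat -> 'I_n.+1 -> 'rV[R]_n -> R,
     (forall j l, polyfun (m - n) (W j l)) ->
     (forall j s, \sum_l W j l s = 0) ->
     I (cdom (vcell R w)) (fun x => dot
       (bub1 (ht x) *: \sum_(j < N) ht x ^+ j *: a j (pos w (yy x)))
       (\sum_l (\sum_(j < N) ht x ^+ j * W j l (yy x)) *: vtx R (w l)) * g)
       = 0%E) ->
  forall j, (j < N)%N -> tvanish w (a j).
Proof.
move=> Idef n0 g0 aP a0 Imoments.
have /choice[V VP] := fun j => ned_bubble n0 (aP j) (a0 j).
pose v l x := \sum_(j < N) ht x ^+ j * V j l (yy x).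
have VPl l j : polyfun (m - n) (V j l) by case: (VP j).
have vball := definite_squares (v := v)
  (om := fun l x => bub1 (ht x) * \prod_(i | i != l) bar (yy x) i)
  Idef (simplex_radius_gt0 R n) ball_vcell g0.
suff Vz l j s : (j < N)%N -> V j l s = 0.
  by move=> j jN s l; have [_ _ ->] := VP j; rewrite Vz // mulr0.
move=> jN; apply: (time_ball_eq0 (N := N) (c := fun j => V j l) (VPl l)) => //.
move=> x xb.
rewrite -/(v l x); apply: vball xb.
- move=> i z; apply: (continuousM (s := fun x => bub1 (ht x))).
    exact: continuous_bub1.
  exact: continuous_prod_bar polyfun_lsubmx _.
- move=> i; exact: (continuous_time_sum (c := fun j => V j i) (VPl i)).
- move=> i z [/std_simplexP z0 /bub1_ge0 t0].
  by rewrite mulr_ge0 // prodr_ge0.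
- move=> i z /ball_vcenter[zb /lt_trans/(_ simplex_radius_lt1)/bub1_gt0 t0].
  by rewrite mulr_gt0 // prodr_gt0 // => p _; exact: bar_gt0.
clear l j s jN x.
rewrite -(Imoments V) // => [|j s]; last by case: (VP j).
congr (I _ _); apply/funext => z; congr (_ * _).
rewrite dotZl dot_suml mulr_sumr.
under [RHS]eq_bigr => j _.
  rewrite dotZl (dot_comb w (a j)); last first.
    rewrite exchange_big big1 //= => i _; rewrite -mulr_sumr.
    by have [_ -> _] := VP i; rewrite mulr0.
  over.
rewrite /=; under eq_bigr => l _.
  rewrite expr2 mulrA {2}/v mulr_sumr.
  over.
rewrite exchange_big /=; apply: eq_bigr => j _.
rewrite mulrA mulr_sumr; apply: eq_bigr => l _.
have [_ _ ->] := VP j; rewrite -/(v l z); ring.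
Qed.

(** The coefficients are the product of all the barycentric coordinates of the
    face times polynomials C_j, and the test function is sum_j t^j C_j.  Over a
    vertex there is nothing to divide by: the only coordinate is the constant 1
    and the coefficients are constants, which is why m > 1 is required. *)
Lemma scalar_time_step (I : set 'rV[R]_(n + 1) -> _ -> \bar R) m N
    (b : nat -> 'rV[R]_3 -> R) g :
  definite I -> (1 < m)%N -> 0 < g -> (forall j, polyfun m (b j)) ->
  ((0 < n)%N -> forall j i (s : 'rV[R]_n), bar s i = 0 -> b j (pos w s) = 0) ->
  (forall c : nat -> 'rV[R]_n -> R, (forall j, polyfun (m - n.+1) (c j)) ->
     I (cdom (vcell R w)) (fun x =>
       (\sum_(j < N) ht x ^+ j * b j (pos w (yy x))) *
       (\sum_(j < N) ht x ^+ j * c j (yy x)) * g) = 0%E) ->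
  forall j s, (j < N)%N -> b j (pos w s) = 0.
Proof.
move=> Idef m1 g0 bP b0 Imoments.
have /choice[C CP] : forall j, exists C, polyfun (m - n.+1) C /\
    forall s, b j (pos w s) = (\prod_i bar s i) * C s.
  move=> j; have bj := polyfun_comp (polyfun_pos R w) (bP j).
  have [n0|n0] := posnP n; last first.
    have [||g' g'P g'E] := polyfun_div_bubble (r := index_enum 'I_n.+1) n0 _ bj.
    - exact: index_enum_uniq.
    - by move=> i s _; exact: b0.
    by exists g'; split=> //; move: g'P; rewrite -sum1_size sum1_card card_ord.
  (* over a vertex: the parameter space is a point *)
  exists (fun s => b j (pos w 0)).
  have s0 (s : 'rV[R]_n) : s = 0 by apply/rowP => -[i i_n]; lia.
  split=> [|s].
    have -> : (m - n.+1 = (m - 2).+1)%N by lia.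
    exact: polyfun_cst.
  rewrite [s]s0 big1 ?mul1r // => i _.
  case: (unliftP ord0 i) => [[l ln]|] ->; first by lia.
  by rewrite bar0 big1 ?subr0 // => l _; rewrite mxE.
have CPj j : polyfun (m - n.+1) (C j) by case: (CP j).
pose v (_ : 'I_1) x := \sum_(j < N) ht x ^+ j * C j (yy x).
have vball := definite_squares (v := v)
  (om := fun _ x => \prod_i bar (yy x) i)
  Idef (simplex_radius_gt0 R n) ball_vcell g0.
move=> j s jN; rewrite (CP j).2 (time_ball_eq0 CPj (N := N)) ?mulr0 //.
move=> x xb; rewrite -/(v ord0 x); apply: vball xb.
- move=> ?; exact: continuous_prod_bar polyfun_lsubmx.
- move=> ?; exact: (continuous_time_sum CPj).
- by move=> _ z [/std_simplexP z0 _]; rewrite prodr_ge0.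
- by move=> _ z /ball_vcenter[zb _]; rewrite prodr_gt0 // => i _; exact: bar_gt0.
rewrite -(Imoments C) //; congr (I _ _); apply/funext => z; congr (_ * _).
rewrite big_ord1 -/(v ord0 z) expr2 mulrA; congr (_ * _).
rewrite /v mulr_sumr; apply: eq_bigr => i _; rewrite (CP i).2; ring.
Qed.

End Steps.

(** * Degrees of freedom as moments on the parameter domains *)

Section TestFunctions.
Variable R : realType.

Lemma polyfun_ypart i : polyfun 2 (fun x : 'rV[R]_4 => ypart x 0 i).
Proof.
apply: polyfun_ext (polyfun_coord R (@lshift 3 1 i)) => x.
by rewrite /ypart mxE.
Qed.

Lemma polyfun_x4 : polyfun 2 (@x4 R).
Proof. exact: polyfun_coord. Qed.

Lemma polyfun_time_sum m N (c : nat -> 'rV[R]_3 -> R) :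
  (forall j, polyfun m (c j)) ->
  polyfun (m + N) (fun x => \sum_(j < N) x4 x ^+ j * c j (ypart x)).
Proof.
move=> cP; apply: polyfun_sum => j _.
have H p : polyfun (m + p) (fun x => x4 x ^+ p * c j (ypart x)).
  elim: p => [|p IH].
    rewrite addn0; apply: polyfun_ext (polyfun_comp polyfun_ypart (cP j)) => x.
    by rewrite expr0 mul1r.
  rewrite addnS; apply: polyfun_ext (polyfunM_aff polyfun_x4 IH) => x.
  by rewrite exprS mulrA.
by apply: polyfun_leq (H j); rewrite leq_add2l ltnW.
Qed.

Lemma comb_diff n (w : 'I_n.+1 -> 'I_4) (c : 'I_n.+1 -> R) : \sum_l c l = 0 ->
  \sum_l c l *: vtx R (w l) =
  \sum_j c (lift ord0 j) *: (vtx R (w (lift ord0 j)) - vtx R (w ord0)).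
Proof.
rewrite big_ord_recl => /eqP; rewrite addr_eq0 => /eqP c0.
rewrite big_ord_recl c0 scaleNr addrC scaler_suml -sumrB.
by apply: eq_bigr => j _; rewrite scalerBr.
Qed.

(** A combination of the vertices with weights of sum zero is a combination of
    edge vectors, so it is tangent to the face. *)
Lemma tangent_comb n (w : 'I_n.+1 -> 'I_4) p (c : cell R p)
    (S : set ('rV[R]_4 -> R)) (W : 'I_n.+1 -> 'rV[R]_4 -> R) :
  (forall x, \sum_l W l x = 0) ->
  (forall v : 'I_n.+1 -> R, S (fun x => \sum_l v l * W l x)) ->
  tangent_field (fdir R w) c S (fun x => pt (\sum_l W l x *: vtx R (w l)) 0).
Proof.
move=> W0 WS; split=> [i|x _]; last first.
  rewrite comb_diff // -[pt _ _](_ : (\row_j W (lift ord0 j) x) *m fdir R w = _).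
    exact: submxMl.
  rewrite fdirE; congr (pt _ _); apply: eq_bigr => j _; by rewrite mxE.
rewrite (_ : (fun _ => _) =
    fun x => \sum_l (pt (vtx R (w l)) 0 : 'rV_4) 0 i * W l x); first exact: WS.
apply/funext => x; rewrite -pt_sum summxE; apply: eq_bigr => l _.
by rewrite mxE mulrC.
Qed.

Lemma row_fdir (w : 'I_2 -> 'I_4) :
  row 0 (fdir R w) = pt (vtx R (w (lift ord0 0)) - vtx R (w ord0)) 0.
Proof. by apply/rowP => i; rewrite !mxE. Qed.

Lemma enorm_edge_neq0 (w : 'I_2 -> 'I_4) : is_face w ->
  enorm (row 0 (fdir R w)) != 0.
Proof.
move=> wP; rewrite sqrtr_eq0 -ltNge lt_def dot_ge0 andbT.
apply/eqP => /dot_eq0; rewrite rowE => /(fdir_free wP)/rowP/(_ 0).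
by rewrite !mxE eqxx => /eqP; rewrite oner_eq0.
Qed.

(** For edges the test functions are scalar and multiply the unit tangent; the
    length of the edge compensates for the normalization. *)
Lemma edge_pairing (w : 'I_2 -> 'I_4) (a : 'rV[R]_3) b (c : 'I_2 -> R) :
  is_face w -> \sum_l c l = 0 ->
  dot (pt a b) (utan (row 0 (fdir R w))) *
    (enorm (row 0 (fdir R w)) * c (lift ord0 0)) =
  dot a (\sum_l c l *: vtx R (w l)).
Proof.
move=> wP c0; have e0 := enorm_edge_neq0 wP.
rewrite comb_diff // big_ord1 dotZr /utan dotZr [in dot _ (row _ _)]row_fdir.
rewrite dot_pt mulr0 addr0; move: (dot _ _) (c _) => x y.
by move: e0; move: (enorm _) => z e0; field.
Qed.

End TestFunctions.

Section Moments.
Variables (R : realType) (k : nat) (E : 'rV[R]_4 -> 'rV[R]_4).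
Variables (A : R -> 'rV[R]_3 -> 'rV[R]_3) (B : R -> 'rV[R]_3 -> R).
Hypothesis EE : forall y t, E (pt y t) = pt (A t y) (B t y).

(** The moments on F x {t} against the test fields sum W_l v_l with
    sum W_l = 0, pulled back to the parameter domain.  The cases of edges,
    triangles and the tetrahedron then differ only in the dimension n. *)
Definition hmoments n (w : 'I_n.+1 -> 'I_4)
    (I : set 'rV[R]_n -> ('rV[R]_n -> R) -> \bar R) t :=
  forall W : 'I_n.+1 -> 'rV[R]_n -> R, (forall l, polyfun (k.+1 - n) (W l)) ->
    (forall s, \sum_l W l s = 0) ->
    I (@std_simplex R n) (fun s => dot (A t (pos w s))
      (\sum_l W l s *: vtx R (w l)) * gram (cdir (hcell w t))) = 0%E.

Lemma hmoments_edge (w : 'I_2 -> 'I_4) t : dof_edges k E -> is_face w ->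
  t = -1 \/ t = 1 -> hmoments w (@int1 R) t.
Proof.
move=> [dofE _] wP tP W WP W0.
pose q x := enorm (row 0 (fdir R w)) * W (lift ord0 0) (loc w (ypart x)).
rewrite -(dofE w t wP tP q).
  rewrite /cint1 /int1 /=; congr (integral _ _ _); apply/funext => s.
  rewrite cmap_hcell EE /q ypart_pt (pos_loc wP).
  by rewrite (@edge_pairing R w _ _ (fun l => W l (Defs.row1 s))).
apply: (@polyfun_Ppoly _ _ (k.+1 - 1)); first by lia.
apply: polyfunZ; apply: polyfun_comp (WP _) => i.
exact: polyfun_comp (polyfun_ypart R) (polyfun_loc R w i).
Qed.

Lemma htest n (w : 'I_n.+1 -> 'I_4) t (W : 'I_n.+1 -> 'rV[R]_n -> R) :
  (forall l, polyfun (k.+1 - n) (W l)) -> (forall s, \sum_l W l s = 0) ->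
  tangent_field (fdir R w) (hcell w t) (Ppoly (k%:Z - n%:Z))
    (fun x => pt (\sum_l W l (loc w (ypart x)) *: vtx R (w l)) 0).
Proof.
move=> WP W0.
apply: (@tangent_comb R n w _ _ _ (fun l x => W l (loc w (ypart x)))) => [x|v].
  exact: W0.
apply: (@polyfun_Ppoly _ _ (k.+1 - n)); first by lia.
apply: polyfun_sum => l _; apply: polyfunZ; apply: polyfun_comp (WP _) => i.
exact: polyfun_comp (polyfun_ypart R) (polyfun_loc R w i).
Qed.

Lemma hmoments_triangle (w : 'I_3 -> 'I_4) t : dof_triangles k E -> is_face w ->
  t = -1 \/ t = 1 -> hmoments w (@int2 R) t.
Proof.
move=> dofE wP tP W WP W0; rewrite -(dofE w t wP tP _ (htest w t WP W0)).
rewrite /cint2 /int2 /=; congr (integral _ _ _); apply/funext => s.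
by rewrite cmap_hcell EE ypart_pt (pos_loc wP) dot_pt mulr0 addr0.
Qed.

Lemma hmoments_tet (w : 'I_4 -> 'I_4) t : dof_tets k E -> is_face w ->
  t = -1 \/ t = 1 -> hmoments w (@int3 R) t.
Proof.
move=> dofE wP tP W WP W0; rewrite -(dofE w t wP tP _ (htest w t WP W0)).
rewrite /cint3 /int3 /=; congr (integral _ _ _); apply/funext => s.
by rewrite cmap_hcell EE ypart_pt (pos_loc wP) dot_pt mulr0 addr0.
Qed.

Local Notation ht x := (rsubmx x 0 0).

(** The same on F x [-1, 1], with weights that are polynomials in t. *)
Definition vmoments n (w : 'I_n.+1 -> 'I_4)
    (I : set 'rV[R]_(n + 1) -> ('rV[R]_(n + 1) -> R) -> \bar R) :=
  forall W : nat -> 'I_n.+1 -> 'rV[R]_n -> R,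
    (forall j l, polyfun (k.+1 - n) (W j l)) ->
    (forall j s, \sum_l W j l s = 0) ->
    I (cdom (vcell R w)) (fun x => dot (A (ht x) (pos w (lsubmx x)))
      (\sum_l (\sum_(j < k.+1 - 2) ht x ^+ j * W j l (lsubmx x)) *: vtx R (w l))
      * gram (cdir (vcell R w))) = 0%E.

Lemma vmoments_quad (w : 'I_2 -> 'I_4) : dof_quads k E -> is_face w ->
  vmoments w (@int2 R).
Proof.
move=> dofE wP W WP W0.
have [_ {}dofE] := dofE w wP.
pose c j y := enorm (row 0 (fdir R w)) * W j (lift ord0 0) (loc w y).
pose q x := \sum_(j < k.+1 - 2) x4 x ^+ j * c j (ypart x).
rewrite -(dofE q).
  rewrite /cint2 /int2 /=; congr (integral _ _ _); apply/funext => s.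
  rewrite (@cmap_vcell R 1 w) EE /q ypart_pt x4_pt; congr (_ * _)%:E.
  set x : 'rV[R]_(1 + 1) := Defs.row2 s.
  rewrite -(edge_pairing _ (B (ht x) (pos w (lsubmx x))) wP); last first.
    by rewrite exchange_big big1 //= => j _; rewrite -mulr_sumr W0 mulr0.
  congr (_ * _); rewrite mulr_sumr; apply: eq_bigr => j _.
  by rewrite /c (pos_loc wP) mulrCA.
apply: tprod_sum => [|j]; first by lia.
apply: (@polyfun_Ppoly _ _ (k.+1 - 1)); first by lia.
exact/polyfunZ/(polyfun_comp (polyfun_loc R w)).
Qed.

Lemma vmoments_prism (w : 'I_3 -> 'I_4) : dof_prisms k E -> is_face w ->
  vmoments w (@int3 R).
Proof.
move=> dofE wP W WP W0; have [{}dofE _] := dofE w wP.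
pose q l x := \sum_(j < k.+1 - 2) x4 x ^+ j * W j l (loc w (ypart x)).
rewrite -(dofE (fun x => pt (\sum_l q l x *: vtx R (w l)) 0)).
  rewrite /cint3 /int3 /=; congr (integral _ _ _); apply/funext => s.
  rewrite (@cmap_vcell R 2 w) EE /q ypart_pt x4_pt (pos_loc wP).
  by rewrite dot_pt mulr0 addr0.
apply: tangent_comb => [x|v].
  by rewrite exchange_big big1 //= => j _; rewrite -mulr_sumr W0 mulr0.
rewrite (_ : (fun _ => _) = fun x => \sum_(j < k.+1 - 2) x4 x ^+ j *
    (\sum_l v l * W j l (loc w (ypart x)))).
  apply: (tprod_sum (a := fun j y => \sum_l v l * W j l (loc w y))) => [|j].
    by lia.
  apply: (@polyfun_Ppoly _ _ (k.+1 - 2)); first by lia.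
  apply: polyfun_sum => l _.
  exact/polyfunZ/(polyfun_comp (polyfun_loc R w)).
apply/funext => x; rewrite /q; under eq_bigr do rewrite mulr_sumr.
rewrite exchange_big; apply: eq_bigr => j _; rewrite mulr_sumr.
by apply: eq_bigr => l _; rewrite mulrCA.
Qed.

(** The moments of the vertical component on F x [-1, 1]. *)
Definition smoments n (w : 'I_n.+1 -> 'I_4)
    (I : set 'rV[R]_(n + 1) -> ('rV[R]_(n + 1) -> R) -> \bar R) :=
  forall c : nat -> 'rV[R]_n -> R, (forall j, polyfun (k.+1 - n.+1) (c j)) ->
    I (cdom (vcell R w)) (fun x => B (ht x) (pos w (lsubmx x)) *
      (\sum_(j < k) ht x ^+ j * c j (lsubmx x)) *
      gram (cdir (vcell R w))) = 0%E.

Lemma dot_e4 (a : 'rV[R]_3) b : dot (pt a b) (e4 R) = b.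
Proof. by rewrite /e4 dot_pt dot0r add0r mulr1. Qed.

Lemma smoments_edge (w : 'I_1 -> 'I_4) : dof_edges k E -> is_face w ->
  smoments w (@int1 R).
Proof.
move=> [_ dofE] wP c cP.
pose q x := \sum_(j < k) x4 x ^+ j * c j (loc w (ypart x)).
rewrite -(dofE w wP q).
  rewrite /cint1 /int1 /=; congr (integral _ _ _); apply/funext => s.
  rewrite (@cmap_vcell R 0 w) EE /q ypart_pt x4_pt (pos_loc wP).
  congr ((_ * _) * _)%:E.
  have -> : row 0 (col_mx (fdir R w) (e4 R)) = e4 R.
    apply/rowP => i; rewrite mxE.
    apply: etrans (col_mxEd (fdir R w) (e4 R) 0 i).
    by congr (fun_of_matrix _ _ _); exact: val_inj.
  rewrite /utan (_ : enorm _ = 1) ?invr1 ?scale1r ?dot_e4 //.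
  by rewrite /enorm {1}/e4 dot_e4 sqrtr1.
apply: (@polyfun_Ppoly _ _ k); first by lia.
(* on a vertical edge only polynomials in t remain *)
have c0 j s : c j s = c j 0 by congr (c j _); apply/rowP => -[].
have monP p (z : R) : polyfun p.+1 (fun x : 'rV[R]_4 => x4 x ^+ p * z).
  elim: p => [|p IH].
    by apply: polyfun_ext (polyfun_cst _ 0 z) => x; rewrite expr0 mul1r.
  apply: polyfun_ext (polyfunM_aff (polyfun_x4 R) IH) => x.
  by rewrite exprS mulrA.
apply: (@polyfun_ext _ _ _ (fun x => \sum_(j < k) x4 x ^+ j * c j 0)) => [x|].
  by apply: eq_bigr => j _; rewrite [in RHS]c0.
by apply: polyfun_sum => j _; apply: polyfun_leq (ltn_ord j) (monP j _).
Qed.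

Lemma smoments_quad (w : 'I_2 -> 'I_4) : dof_quads k E -> is_face w ->
  smoments w (@int2 R).
Proof.
move=> dofE wP c cP; have [{}dofE _] := dofE w wP.
rewrite -(dofE (fun x => \sum_(j < k) x4 x ^+ j *
    c j (loc w (ypart x)))).
  rewrite /cint2 /int2 /=; congr (integral _ _ _); apply/funext => s.
  by rewrite (@cmap_vcell R 1 w) EE ypart_pt x4_pt (pos_loc wP) dot_e4.
apply: (tprod_sum (a := fun j y => c j (loc w y))) => [|j]; first by lia.
apply: (@polyfun_Ppoly _ _ (k.+1 - 2)); first by lia.
exact: (polyfun_comp (polyfun_loc R w)).
Qed.

Lemma smoments_prism (w : 'I_3 -> 'I_4) : dof_prisms k E -> is_face w ->
  smoments w (@int3 R).
Proof.
move=> dofE wP c cP; have [_ {}dofE] := dofE w wP.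
rewrite -(dofE (fun x => \sum_(j < k) x4 x ^+ j *
    c j (loc w (ypart x)))).
  rewrite /cint3 /int3 /=; congr (integral _ _ _); apply/funext => s.
  by rewrite (@cmap_vcell R 2 w) EE ypart_pt x4_pt (pos_loc wP) dot_e4.
apply: (tprod_sum (a := fun j y => c j (loc w y))) => [|j]; first by lia.
apply: (@polyfun_Ppoly _ _ (k.+1 - 3)); first by lia.
exact: (polyfun_comp (polyfun_loc R w)).
Qed.

End Moments.

(** * Unisolvence on the prism *)

Section Traces.
Variable R : realType.
Implicit Type u : 'rV[R]_3 -> 'rV[R]_3.

Lemma facet_vdot n (w : 'I_n.+2 -> 'I_4) u (i l : 'I_n.+2) (s : 'rV[R]_n.+1) :
  tvanish (fun p : 'I_n.+1 => w (lift i p)) u -> bar s i = 0 -> l != i ->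
  vdot w u l s = 0.
Proof.
move=> ut /(pos_facet w)[s' sE]; case: (unliftP i l) => [p ->|->].
  by move=> _; rewrite /vdot sE; exact: ut.
by rewrite eqxx.
Qed.

Lemma tvanish_point (w : 'I_1 -> 'I_4) u : tvanish w u.
Proof.
move=> s l; rewrite /vdot /pos big_ord1 [l]ord1 bar0 big_ord0 subr0 scale1r.
by rewrite subrr dot0r.
Qed.

Definition idface : 'I_4 -> 'I_4 := id.

Lemma idface_face : @is_face 3 idface. Proof. by []. Qed.

Lemma bar_loc_id (y : 'rV[R]_3) l : bar (@loc R 3 idface y) l = lam l y.
Proof.
case: (unliftP ord0 l) => [j|] ->; first by rewrite bar_lift mxE.
rewrite bar0 -(sum_lam y) big_ord_recl.
rewrite [X in _ - X](eq_bigr (fun j => lam (lift ord0 j) y)) ?addrK //.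
by move=> j _; rewrite mxE.
Qed.

Lemma pos_loc_id (y : 'rV[R]_3) : pos idface (@loc R 3 idface y) = y.
Proof.
rewrite /pos -[RHS]lam_expansion; apply: eq_bigr => l _.
by rewrite bar_loc_id.
Qed.

Lemma vdot_id u l y :
  vdot idface u l (@loc R 3 idface y) = dot (u y) (vtx R l - y).
Proof. by rewrite /vdot pos_loc_id. Qed.

Lemma tvanish_id u : @tvanish R 3 idface u -> forall y, u y = 0.
Proof.
move=> u0 y; rewrite [u y](grad_expansion y) big1 // => l _.
by rewrite -vdot_id u0 scale0r.
Qed.

(** The coordinates of a vector of sum zero in the basis e_(r+1) - e_r. *)
Definition whit (c : 'I_4 -> R) (r : 'I_3) : R :=
  - \sum_(l : 'I_4 | (l <= r)%N) c l.

(** A vector c of sum zero is a combination of the differences e_(r+1) - e_r of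
    neighbouring basis vectors.  For such a difference the left-hand side is
    lam_c lam_d (lam_a grad lam_b - lam_b grad lam_a) with (a, b, c, d) a cyclic
    shift of (1, 2, 3, 4), that is, one of the fields Phi^r N^r. *)
Lemma whitney_expansion (y : 'rV[R]_3) (c : 'I_4 -> R) : \sum_l c l = 0 ->
  \sum_l ((\prod_(i | i != l) lam i y) * c l) *: grad_lam l y =
  \sum_r (whit c r * Phib r y) *: Nwhit r y.
Proof.
move=> c0.
have cycE (r : 'I_3) m (l : 'I_4) : ((r + m) %% 4 = l)%N -> cyc r m = l.
  by move=> rm; apply: val_inj; rewrite /cyc /= inordK ?rm.
pose o0 : 'I_4 := ord0; pose o1 : 'I_4 := Ordinal (isT : 1 < 4)%N.
pose o2 : 'I_4 := Ordinal (isT : 2 < 4)%N; pose o3 : 'I_4 := ord_max.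
have e1 : lift ord0 ord0 = o1 by exact: val_inj.
have e2 : lift ord0 (lift ord0 ord0) = o2 by exact: val_inj.
have e3 : lift ord0 (lift ord0 (lift ord0 ord0)) = o3 by exact: val_inj.
have c3 : c o3 = - (c o0 + c o1 + c o2).
  apply/eqP; rewrite -addr_eq0 -c0 !big_ord_recl big_ord0 e1 e2 e3; apply/eqP.
  by ring.
rewrite !big_ord_recl !big_ord0 /whit /Phib /Nwhit.
rewrite !(big_mkcond (fun _ : 'I_4 => (_ <= _)%N)).
rewrite !(big_mkcond (fun _ : 'I_4 => _ != _)).
rewrite !big_ord_recl !big_ord0 e1 e2 e3 /=.
have r0 : (cyc ord0 0 = o0) * (cyc ord0 1 = o1) * (cyc ord0 2 = o2) *
    (cyc ord0 3 = o3) by do !split; apply: cycE.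
have r1 : (cyc (lift ord0 ord0) 0 = o1) * (cyc (lift ord0 ord0) 1 = o2) *
    (cyc (lift ord0 ord0) 2 = o3) * (cyc (lift ord0 ord0) 3 = o0).
  by do !split; apply: cycE.
have r2 : (cyc (lift ord0 (lift ord0 ord0)) 0 = o2) *
    (cyc (lift ord0 (lift ord0 ord0)) 1 = o3) *
    (cyc (lift ord0 (lift ord0 ord0)) 2 = o0) *
    (cyc (lift ord0 (lift ord0 ord0)) 3 = o1) by do !split; apply: cycE.
rewrite !(r0, r1, r2) c3; apply/rowP => j; rewrite !mxE.
ring.
Qed.

Lemma lincomb_closed_ned m : lincomb_closed (@ned R m).
Proof. by split; [exact: ned0|exact: nedD|exact: nedZ]. Qed.

Lemma lincomb_closed_polyfun m :
  @lincomb_closed R R^o (fun f : 'rV[R]_3 -> R^o => polyfun m (f : _ -> R)).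
Proof. by split; [exact: polyfun0|exact: polyfunD|exact: polyfunZ]. Qed.

Lemma VkL1_expand k (E : 'rV[R]_4 -> 'rV[R]_4) : (0 < k)%N -> VkL1 k E ->
  exists (a : nat -> 'rV[R]_3 -> 'rV[R]_3) (b : nat -> 'rV[R]_3 -> R),
    [/\ forall j, ned k.+1 (a j), forall j, polyfun k.+1 (b j) &
      forall y t, E (pt y t) = pt (\sum_(j < k.+1) t ^+ j *: a j y)
                                 (\sum_(j < k) t ^+ j * b j y)].
Proof.
move=> k0 [A [B [AP BP EE]]].
have nedW u : nedelec k.-1 u -> ned k.+1 u by move/nedelec_ned; rewrite prednK.
have polyW (f : 'rV[R]_3 -> R^o) : Ppoly k%:Z f -> polyfun k.+1 (f : _ -> R).
  by apply: Ppoly_polyfun; lia.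
have kA : k%:Z + 1 <= k.+1%:Z by lia.
have kB : k%:Z - 1 + 1 <= k%:Z by lia.
have [a [aP aE]] := tprod_expand (lincomb_closed_ned k.+1) nedW kA AP.
have [b [bP bE]] := tprod_expand (lincomb_closed_polyfun k.+1) polyW kB BP.
exists a, b; split=> // y t.
by rewrite EE -ptD addr0 add0r aE bE x4_pt ypart_pt.
Qed.

End Traces.

(** Every y_i within 1/3 of -2/3 lies between -1 and -1/3, so three of them add
    up to at most -1. *)
Lemma N4_ball (R : realType) :
  ball (pt (const_mx (- 2 / 3)) 0 : 'rV[R]_4) 3^-1 `<=` @N4 R.
Proof.
have radius3 : 0 < 3^-1 :> R by rewrite invr_gt0.
move=> x /(ball_row _ _ radius3) h.
have {}h i : `|(pt (const_mx (- 2 / 3)) 0 : 'rV[R]_4) 0 i - x 0 i| < 3^-1.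
  exact: h.
have hy i : - 1 < ypart x 0 i < - 3^-1.
  have := h (@lshift 3 1 i); rewrite (row_mxEl _ _ 0 i) mxE.
  rewrite ltr_norml (_ : x 0 (lshift 1 i) = ypart x 0 i); last by rewrite mxE.
  by move=> /andP[h1 h2]; apply/andP; split; lra.
have ht : -1 <= x4 x <= 1.
  have := h ord_max; rewrite -/(x4 _) -/(x4 x) x4_pt ltr_norml => /andP[h1 h2].
  by apply/andP; split; lra.
split=> //; split=> [i|].
  by have /andP[h1 h2] := hy i; apply/andP; split; lra.
rewrite !big_ord_recl big_ord0.
have /andP[_ h0] := hy ord0; have /andP[_ h1] := hy (lift ord0 ord0).
have /andP[_ h2] := hy (lift ord0 (lift ord0 ord0)); lra.
Qed.

Lemma ball_N4_zero (R : realType) m (L : finType) (v : L -> 'rV[R]_4 -> R) :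
  (forall l, polyfun m (v l)) ->
  intN4 (fun x => \sum_l v l x ^+ 2) = 0%E -> forall l x, v l x = 0.
Proof.
move=> vP v0 l; have r0 : 0 < 3^-1 :> R by rewrite invr_gt0.
apply: (polyfun_ball_eq0 (vP l) r0) => x.
apply: (definite_squares (v := v) (om := fun _ _ => 1) (@definite_int4 R) r0
  (@N4_ball R) ltr01) => //.
- by move=> _; exact: cst_continuous.
- by move=> i; exact: polyfun_continuous (vP i).
rewrite -v0; congr (integral _ _ _); apply/funext => s; congr EFin.
by rewrite mulr1; apply: eq_bigr => i _; rewrite mul1r.
Qed.

Section Unisolvence.
Variables (R : realType) (k : nat) (E : 'rV[R]_4 -> 'rV[R]_4).
Variables (a : nat -> 'rV[R]_3 -> 'rV[R]_3) (b : nat -> 'rV[R]_3 -> R).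
Hypothesis k0 : (0 < k)%N.
Hypothesis aP : forall j, ned k.+1 (a j).
Hypothesis bP : forall j, polyfun k.+1 (b j).
Local Notation A t y := (\sum_(j < k.+1) t ^+ j *: a j y).
Local Notation B t y := (\sum_(j < k) t ^+ j * b j y).
Hypothesis EE : forall y t, E (pt y t) = pt (A t y) (B t y).
Hypothesis dofE : dofs_vanish k E.

(* the components as functions of t, the form in which they enter the moments *)
Let EE' : forall y t,
  E (pt y t) = pt ((fun t y => A t y) t y) ((fun t y => B t y) t y).
Proof. exact: EE. Qed.

(** For fixed t = -1 or t = 1 the tangential part is a single Nedelec field on
    the tetrahedron; its traces vanish on edges, then on triangles, and finally
    on the tetrahedron itself. *)
Lemma tangential_end_zero t : t = -1 \/ t = 1 -> forall y, A t y = 0.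
Proof.
move=> tP; have [[dof1 dof2 _] [dof3 _ _ _]] := dofE.
pose u y := A t y.
have uP : ned k.+1 u.
  exact: (lincomb_closed_sum (fun j => t ^+ j) (a := fun j => a j)
    (lincomb_closed_ned R k.+1)).
have tv1 (w : 'I_2 -> 'I_4) : is_face w -> tvanish w u.
  move=> wP; apply: (@tvanish_step R 1 w _ _ _ _
    (@definite_int1 R) isT (gram_hcell_gt0 wP t) uP).
    by move=> i l s; apply: facet_vdot; exact: tvanish_point.
  exact: (hmoments_edge EE' dof1 wP tP).
have tv2 (w : 'I_3 -> 'I_4) : is_face w -> tvanish w u.
  move=> wP; apply: (@tvanish_step R 2 w _ _ _ _
    (@definite_int2 R) isT (gram_hcell_gt0 wP t) uP).
    by move=> i l s; apply: facet_vdot; apply: tv1; exact: face_lift.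
  exact: (hmoments_triangle EE' dof2 wP tP).
apply: (@tvanish_id R u).
apply: (@tvanish_step R 3 idface _ _ _ _
    (@definite_int3 R) isT (gram_hcell_gt0 idface_face t) uP).
  by move=> i l s; apply: facet_vdot; apply: tv2; exact: face_lift.
exact: (hmoments_tet EE' dof3 idface_face tP).
Qed.

Lemma tangential_bubble : exists a' : nat -> 'rV[R]_3 -> 'rV[R]_3,
  (forall j, ned k.+1 (a' j)) /\
  forall t y, A t y = bub1 t *: \sum_(j < k.+1 - 2) t ^+ j *: a' j y.
Proof.
have [M ME] := bub1_division R k.+1.
exists (fun j y => \sum_(i < k.+1) M j i *: a i y); split=> [j|t y].
  exact: (lincomb_closed_sum (fun i => M j i) (a := fun i => a i)
    (lincomb_closed_ned R k.+1)).
apply: (ME _ (fun j => a j y)) => {}t tP; exact: tangential_end_zero.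
Qed.

(** On the triangular faces times [-1, 1] all the coefficients have zero
    tangential trace, and in the interior the tangential part of E is one of the
    test fields: the last moment is the integral of the square of its norm. *)
Lemma tangential_zero t y : A t y = 0.
Proof.
have [[_ _ dof1] [_ dof2 dof3 _]] := dofE.
(* extending the coefficients by zero makes the trace statements uniform in j *)
have [a'' [a''P AE'']] := tangential_bubble.
pose a' j y := if (j < k.+1 - 2)%N then a'' j y else 0.
have a'P j : ned k.+1 (a' j).
  by rewrite /a'; case: (j < _)%N; [exact: a''P|exact: ned0].
have {AE''} AE t' y' :
    A t' y' = bub1 t' *: \sum_(j < k.+1 - 2) t' ^+ j *: a' j y'.
  by rewrite AE''; congr (_ *: _); apply: eq_bigr => j _; rewrite /a' ltn_ord.
have tvE n (w : 'I_n.+1 -> 'I_4) :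
    (forall j, (j < k.+1 - 2)%N -> tvanish w (a' j)) ->
    forall j, tvanish w (a' j).
  move=> h j; case: (ltnP j (k.+1 - 2)) => [/h//|jk] s l.
  by rewrite /vdot /a' ltnNge jk dot0l.
have tv1 (w : 'I_2 -> 'I_4) j : is_face w -> tvanish w (a' j).
  move=> wP; apply: tvE => {}j.
  apply: (@tvanish_time_step R 1 w _ _ _ _ _
    (@definite_int2 R) isT (gram_vcell_gt0 R wP) a'P) => //.
    by move=> p i l s; apply: facet_vdot; exact: tvanish_point.
  move=> W WP W0; rewrite -(vmoments_quad EE' dof1 wP WP W0).
  by congr (int2 _ _); apply/funext => x; rewrite AE.
have tv2 (w : 'I_3 -> 'I_4) j : is_face w -> tvanish w (a' j).
  move=> wP; apply: tvE => {}j.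
  apply: (@tvanish_time_step R 2 w _ _ _ _ _
    (@definite_int3 R) isT (gram_vcell_gt0 R wP) a'P) => //.
    by move=> p i l s; apply: facet_vdot; apply: tv1; exact: face_lift.
  move=> W WP W0; rewrite -(vmoments_prism EE' dof2 wP WP W0).
  by congr (int3 _ _); apply/funext => x; rewrite AE.
have /choice[V VP] : forall j, exists V : 'I_4 -> 'rV[R]_3 -> R,
    [/\ forall l, polyfun (k.+1 - 3) (V l), forall s, \sum_l V l s = 0 &
        forall l s, vdot idface (a' j) l s = (\prod_(i | i != l) bar s i) * V l s].
  move=> j; apply: ned_bubble => // i l s; apply: facet_vdot.
  by apply: tv2; exact: face_lift.
pose q (r : 'I_3) (x : 'rV[R]_4) := \sum_(j < k.+1 - 2)
  x4 x ^+ j * whit (fun l => V j l (loc idface (ypart x))) r.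
have qE r y' t' : q r (pt y' t') =
    \sum_(j < k.+1 - 2) t' ^+ j * whit (fun l => V j l (loc idface y')) r.
  by rewrite /q ypart_pt x4_pt.
have a'E j y' : a' j y' =
    \sum_r (whit (fun l => V j l (loc idface y')) r * Phib r y') *: Nwhit r y'.
  rewrite [LHS](grad_expansion y') -whitney_expansion; last by case: (VP j).
  apply: eq_bigr => l _; rewrite -vdot_id; have [_ _ ->] := VP j.
  by congr ((_ * _) *: _); apply: eq_bigr => i _; rewrite bar_loc_id.
have testE y' t' :
    \sum_r (q r (pt y' t') * Phib r y' * bub1 t') *: pt (Nwhit r y') 0 =
    pt (A t' y') 0.
  rewrite pt_sum; congr (pt _ _); rewrite AE scaler_sumr.
  under [RHS]eq_bigr do rewrite a'E scaler_sumr scaler_sumr.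
  rewrite [RHS]exchange_big; apply: eq_bigr => r _.
  rewrite qE !mulr_suml scaler_suml; apply: eq_bigr => j _.
  by rewrite !scalerA; congr (_ *: _); ring.
have qP r : tprodS (P1poly (k%:Z - 2)) (Ppoly (k%:Z - 3)) (q r).
  apply: (tprod_sum (a := fun j y => whit (fun l => V j l (loc idface y)) r)).
    by lia.
  move=> j; apply: (@polyfun_Ppoly _ _ (k.+1 - 3)); first by lia.
  apply: (@polyfun_ext _ _ _ (fun y =>
      -1 * \sum_(l : 'I_4 | (l <= r)%N) V j l (loc idface y))) => [z|].
    by rewrite mulN1r.
  apply: polyfunZ; apply: polyfun_sum => l _.
  by apply: polyfun_comp (polyfun_loc R idface) _; case: (VP j).
pose v (i : 'I_3) (x : 'rV[R]_4) :=
  \sum_(j < k.+1) x4 x ^+ j * a j (ypart x) 0 i.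
have vP i : polyfun (k.+1 + k.+1) (v i).
  by apply: (@polyfun_time_sum R _ k.+1 (fun j y => a j y 0 i)) => j; case: (aP j).
have vE i y' t' : (A t' y') 0 i = v i (pt y' t').
  rewrite summxE /v; apply: eq_bigr => j _.
  by rewrite mxE ypart_pt x4_pt.
apply/rowP => i; rewrite vE mxE.
apply: (ball_N4_zero vP) => {i}.
rewrite -(dof3 q qP); congr (integral _ _ _); apply/funext => s; congr EFin.
rewrite -[row4 s]ptK; set y' := ypart _; set t' := x4 _.
rewrite ypart_pt x4_pt testE EE dot_pt mulr0 addr0 dotE.
by apply: eq_bigr => i _; rewrite vE expr2.
Qed.

(** The coefficients vanish on the vertices, edges and triangles in turn, so
    they are divisible by bub3; the test function whose product with bub3 is the
    vertical part of E turns the last moment into the integral of its square. *)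
Lemma vertical_zero t y : B t y = 0.
Proof.
have [[dof0 _ dof1] [_ dof2 _ dof3]] := dofE.
pose b' j y := if (j < k)%N then b j y else 0.
have b'P j : polyfun k.+1 (b' j).
  by rewrite /b'; case: (j < _)%N; [exact: bP|exact: polyfun0].
have BE t' y' : B t' y' = \sum_(j < k) t' ^+ j * b' j y'.
  by apply: eq_bigr => j _; rewrite /b' ltn_ord.
have bE n (w : 'I_n.+1 -> 'I_4) :
    (forall j (s : 'rV[R]_n), (j < k)%N -> b' j (pos w s) = 0) ->
    forall j (s : 'rV[R]_n), b' j (pos w s) = 0.
  move=> h j s; case: (ltnP j k) => [/h//|jk].
  by rewrite /b' ltnNge jk.
have k1 : (1 < k.+1)%N by [].
have bv0 (w : 'I_1 -> 'I_4) j (s : 'rV[R]_0) : is_face w -> b' j (pos w s) = 0.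
  move=> wP; apply: bE => {j s}.
  apply: (@scalar_time_step R 0 w _ _ _ _ _
    (@definite_int1 R) k1 (gram_vcell_gt0 R wP) b'P) => //.
  move=> c cP; rewrite -(smoments_edge EE' dof0 wP cP).
  by congr (int1 _ _); apply/funext => x; rewrite BE.
have bv1 (w : 'I_2 -> 'I_4) j (s : 'rV[R]_1) : is_face w -> b' j (pos w s) = 0.
  move=> wP; apply: bE => {j s}.
  apply: (@scalar_time_step R 1 w _ _ _ _ _
    (@definite_int2 R) k1 (gram_vcell_gt0 R wP) b'P) => //.
    move=> _ j i s /(pos_facet w)[s' ->]; apply: bv0; exact: face_lift.
  move=> c cP; rewrite -(smoments_quad EE' dof1 wP cP).
  by congr (int2 _ _); apply/funext => x; rewrite BE.
have bv2 (w : 'I_3 -> 'I_4) j (s : 'rV[R]_2) : is_face w -> b' j (pos w s) = 0.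
  move=> wP; apply: bE => {j s}.
  apply: (@scalar_time_step R 2 w _ _ _ _ _
    (@definite_int3 R) k1 (gram_vcell_gt0 R wP) b'P) => //.
    move=> _ j i s /(pos_facet w)[s' ->]; apply: bv1; exact: face_lift.
  move=> c cP; rewrite -(smoments_prism EE' dof2 wP cP).
  by congr (int3 _ _); apply/funext => x; rewrite BE.
have /choice[C CP] : forall j, exists C : 'rV[R]_3 -> R,
    polyfun (k.+1 - 4) C /\
    forall s, b' j (pos idface s) = (\prod_i bar s i) * C s.
  move=> j; have bj := polyfun_comp (polyfun_pos R idface) (b'P j).
  have [|||C CP CE] := polyfun_div_bubble (r := index_enum 'I_4) _ _ bj.
  - by [].
  - exact: index_enum_uniq.
  - move=> i s _ /(pos_facet idface)[s' ->]; apply: bv2; exact: face_lift.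
  by exists C; split=> //; move: CP; rewrite -sum1_size sum1_card card_ord.
pose q (x : 'rV[R]_4) := \sum_(j < k) x4 x ^+ j * C j (loc idface (ypart x)).
have qE x : q x * bub3 (ypart x) = \sum_(j < k) x4 x ^+ j * b' j (ypart x).
  rewrite /q mulr_suml; apply: eq_bigr => j _.
  rewrite -[in RHS](pos_loc_id (ypart x)) (CP j).2 -mulrA; congr (_ * _).
  by rewrite mulrC; congr (_ * _); apply: eq_bigr => i _; rewrite bar_loc_id.
have qP : tprodS (P1poly (k%:Z - 1)) (Ppoly (k%:Z - 4)) q.
  apply: (tprod_sum (a := fun j y => C j (loc idface y))); first by lia.
  move=> j; apply: (@polyfun_Ppoly _ _ (k.+1 - 4)); first by lia.
  by apply: polyfun_comp (polyfun_loc R idface) _; case: (CP j).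
pose v (_ : 'I_1) (x : 'rV[R]_4) := \sum_(j < k) x4 x ^+ j * b' j (ypart x).
have vP i : polyfun (k.+1 + k) (v i) by apply: polyfun_time_sum.
have := ball_N4_zero vP _ ord0 (pt y t); rewrite /v ypart_pt x4_pt -BE; apply.
rewrite -(dof3 q qP); congr (integral _ _ _); apply/funext => s; congr EFin.
rewrite big_ord1 -/(v ord0 _) -[row4 s]ptK; set y' := ypart _; set t' := x4 _.
rewrite EE dot_pt dot0r add0r qE BE /v ypart_pt x4_pt expr2.
by [].
Qed.

End Unisolvence.

Unset Implicit Arguments.

Theorem lemma5p2 (R : realType) (k : nat) (E : 'rV[R]_4 -> 'rV[R]_4)
    (hk : (1 <= k)%N) (hE : VkL1 k E) (hdof : dofs_vanish k E) :
  forall x : 'rV[R]_4, E x = 0.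
Proof.
move=> x; have [a [b [aP bP EE]]] := VkL1_expand hk hE.
rewrite -[x]ptK EE (tangential_zero hk aP EE hdof).
by rewrite (vertical_zero hk bP EE hdof) pt00.
Qed.
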